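(* Let $1\le q<\infty$, and let the parametric family $\{p_\vartheta\}_{\vartheta\in\Theta}$, the true parameter $\vartheta_0$, the i.i.d. sample $X_1,X_2,\dots$ with $X_1\sim p_{\vartheta_0}$, the functions $\eta_n$, $\psi_{n,q}$, and the estimators $\widehat{\vartheta}_{n,q}$ be as described in the context. Assume in addition: (R1) the map $\Theta\ni\vartheta\mapsto \frac{p_\vartheta'(x)}{p_\vartheta(x)}$ is continuous for every $x>0$; (R2) $\Theta$ is a non-empty Borel subset of $\mathbb{R}^d$; (R3) for each non-empty compact subset $K$ of $\Theta$ there exist some $0<\alpha=\alpha_K<\infty$ and a measurable function $H=H_K:(0,\infty)\to[0,\infty)$ with $\mathbb{E}[H(X)\,X]<\infty$ (where $X\sim p_{\vartheta_0}$) such that $$\left|\frac{p_{\vartheta^{(2)}}'(x)}{p_{\vartheta^{(2)}}(x)}-\frac{p_{\vartheta^{(1)}}'(x)}{p_{\vartheta^{(1)}}(x)}\right|\le H(x)\,\big|\vartheta^{(2)}-\vartheta^{(1)}\big|^{\alpha}$$ for every $x>0$ and all $\vartheta^{(1)},\vartheta^{(2)}\in K$. Then: (i) If $\{\widehat{\vartheta}_{n,q}\}_{n\in\mathbb{N}}$ is tight in $\Theta$, then $\widehat{\vartheta}_{n,q}\to\vartheta_0$ in probability as $n\to\infty$. (ii) If $\Theta$ is compact, then $\widehat{\vartheta}_{n,q}\to\vartheta_0$ $\mathbb{P}$-almost surely as $n\to\infty$.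
   Context: Parametric model: $\Theta\subset\mathbb{R}^d$, and $\{p_\vartheta:\vartheta\in\Theta\}$ is a family of probability density functions, each with support $(0,\infty)$, positive and continuously differentiable on $(0,\infty)$; $P_\vartheta$ is the distribution function of $p_\vartheta$. For every $\vartheta\in\Theta$ it is assumed that $$\int_0^\infty |x|\,|p_\vartheta'(x)|\,dx<\infty,\qquad \sup_{x>0}\frac{p_\vartheta'(x)\min\{P_\vartheta(x),1-P_\vartheta(x)\}}{p_\vartheta(x)^2}<\infty,\qquad \lim_{x\searrow0}\frac{P_\vartheta(x)}{p_\vartheta(x)}=0.$$ The parametrization is identifiable: $p_\vartheta\neq p_{\vartheta'}$ whenever $\vartheta\ne\vartheta'$. Sample: $(\Omega,\mathcal{F},\mathbb{P})$ is a complete probability space, $\vartheta_0\in\Theta$ is the true parameter, and $X,X_1,X_2,\dots:\Omega\to(0,\infty)$ are random variables with density $p_{\vartheta_0}$, the sequence $X_1,X_2,\dots$ being i.i.d. It is assumed that $\mathbb{E}\left|\frac{p_\vartheta'(X)}{p_\vartheta(X)}X\right|<\infty$ for every $\vartheta\in\Theta$. Norm: $w:(0,\infty)\to(0,\infty)$ is a positive integrable weight function, and $\|f\|_{L^q}=\left(\int_0^\infty|f(t)|^q\,w(t)\,dt\right)^{1/q}$. Empirical functions: for $t>0$, $\vartheta\in\Theta$, $$\eta_n(t,\vartheta)=-\frac1n\sum_{j=1}^n\frac{p_\vartheta'(X_j)}{p_\vartheta(X_j)}\min\{X_j,t\}-\frac1n\sum_{j=1}^n\mathbf{1}\{X_j\le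 t\},\qquad \psi_{n,q}(\vartheta)=\|\eta_n(\cdot,\vartheta)\|_{L^q}.$$ Estimators: $(\varepsilon_n)_{n\in\mathbb{N}}$ are positive random variables on $\Omega$ with $\varepsilon_n\to0$ $\mathbb{P}$-almost surely, and $\widehat{\vartheta}_{n,q}:\Omega\to\Theta$ is any $(\mathcal{F},\mathcal{B}(\Theta))$-measurable map satisfying, for every $\omega\in\Omega$, $$\psi_{n,q}\big(\widehat{\vartheta}_{n,q}(\omega)\big)(\omega)\le\inf_{\vartheta\in\Theta}\psi_{n,q}(\vartheta)(\omega)+\varepsilon_n(\omega).$$ Tight in $\Theta$ means: for every $\delta>0$ there is a compact set $K\subset\Theta$ with $\sup_{n}\mathbb{P}(\widehat{\vartheta}_{n,q}\notin K)\le\delta$. *)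

(* Defs.v *)
From HB Require Import structures.
From mathcomp Require Export all_boot all_order all_algebra finmap.
From mathcomp Require Export all_classical all_reals all_analysis.

Set Implicit Arguments.
Unset Strict Implicit.
Unset Printing Implicit Defensive.

Import Order.TTheory GRing.Theory Num.Theory.
Export numFieldNormedType.Exports.

Local Open Scope classical_set_scope.
Local Open Scope ring_scope.

(* The norm that the library puts on row vectors is the sup norm. *)
Definition euclidean_norm (R : realType) (m : nat) (v : 'rV[R]_m) : R :=
  Num.sqrt (\sum_(i < m) v ord0 i ^+ 2).

Definition borel_set (T : topologicalType) : set (set T) := <<s @open T >>.

Section densities.
Context {R : realType}.
Local Notation mu := (@lebesgue_measure R).

Definition distribution_function (f : R -> R) (x : R) : R :=
  \int[mu]_(y in `]-oo, x]) f y.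

Definition score (f : R -> R) (x : R) : R := derive1 f x / f x.

Record regular_density (f : R -> R) : Prop := {
  density_pos : forall x : R, 0 < x -> 0 < f x ;
  density_eq0 : forall x : R, x <= 0 -> f x = 0 ;
  density_C1 : forall x : R, 0 < x ->
    derivable f x 1 /\ {for x, continuous (derive1 f)} ;
  density_integral1 : (\int[mu]_x (f x)%:E = 1)%E ;
  density_derive_int :
    (\int[mu]_(x in `]0%R, +oo[) (`|x| * `|derive1 f x|)%:E < +oo)%E ;
  density_derive_sup :
    has_ubound [set derive1 f x * Num.min (distribution_function f x)
                                      (1 - distribution_function f x)
                      / f x ^+ 2 | x in `]0, +oo[] ;
  density_lim0 : distribution_function f x / f x @[x --> 0^'+] --> (0 : R)
}.

Definition Lq_norm (q : R) (w : R -> R) (f : R -> R) : \bar R :=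
  ((\int[mu]_(t in `]0%R, +oo[) (`|f t| `^ q * w t)%:E) `^ q^-1)%E.

End densities.

Section sample.
Context {R : realType} {d : measure_display} {Omega : measurableType d}.
Variable P : probability Omega R.
Local Notation mu := (@lebesgue_measure R).

Definition has_density (X : {RV P >-> R}) (f : R -> R) : Prop :=
  forall A : set R, measurable A ->
    distribution P X A = (\int[mu]_(x in A) (f x)%:E)%E.

Definition mutually_independent (X : nat -> {RV P >-> R}) : Prop :=
  forall (J : {fset nat}) (A : nat -> set R),
    (forall j, measurable (A j)) ->
    P (\bigcap_(j in [set` J]) (X j @^-1` A j)) =
    (\prod_(j <- J) P (X j @^-1` A j))%E.

Context {m : nat}.
Implicit Types (p : 'rV[R]_m -> R -> R) (X : nat -> {RV P >-> R}).

(* The random variable numbered j + 1 in the sample is [X j], so the sum over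
   [j < n] involves the first [n] observations. *)
Definition eta p X (n : nat) (t : R) (theta : 'rV[R]_m) (omega : Omega) : R :=
  - (n%:R^-1 * \sum_(j < n)
       score (p theta) (X j omega) * Num.min (X j omega) t)
  - n%:R^-1 * \sum_(j < n) \1_(`]-oo, t]) (X j omega).

Definition psi p X (n : nat) (q : R) (w : R -> R) (theta : 'rV[R]_m)
    (omega : Omega) : \bar R :=
  Lq_norm q w (fun t => eta p X n t theta omega).

(* The sample size [n] ranges over the positive integers. *)
Definition tight_in (Theta : set 'rV[R]_m) (T : nat -> Omega -> 'rV[R]_m) :=
  forall delta : R, 0 < delta ->
    exists K : set 'rV[R]_m, [/\ compact K, K `<=` Theta &
      (ereal_sup [set P [set omega | ~ K (T n omega)] | n in [set n | (0 < n)%N]]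
       <= delta%:E)%E].

Definition cvg_in_probability (T : nat -> Omega -> 'rV[R]_m) (l : 'rV[R]_m) :=
  forall eps : R, 0 < eps ->
    (P [set omega | (eps < euclidean_norm (T n omega - l))%R] @[n --> \oo]
       --> 0)%E.

End sample.

(* Main.v *)
Require Import Defs.
From HB Require Import structures.
From mathcomp Require Import ring lra measurable_realfun.

(* Write [s theta] for the score [p theta' / p theta], and let X have density
   [p theta0].  With G(t) = E[s(X); X > t], the map
   F(t) = E[s(X) min(X, t)] + P(X <= t) has derivative G + p theta0, and
   G + p theta0 has derivative [(p theta0)' - s * p theta0].  Since F is bounded
   and vanishes at 0, F is identically zero for [theta = theta0]; conversely,
   F = 0 forces [(p theta0)' = s theta * p theta0], so that
   [p theta0 / p theta] is constant and [theta = theta0].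
   By the strong law of large numbers (Etemadi's argument) and the Hölder bound
   on the score, almost surely the empirical functions converge to -F at every
   [t > 0] and every parameter of a compact set, also along convergent sequences
   of parameters.  If the minimizers visiting the compact set [K] were infinitely
   often outside a neighbourhood of [theta0], a subsequence would converge to
   some [theta <> theta0] while the norm of the empirical function tends to 0;
   Fatou's lemma then gives F = 0 almost everywhere at [theta], a
   contradiction. *)

Set Implicit Arguments.
Unset Strict Implicit.
Unset Printing Implicit Defensive.

Import Order.TTheory GRing.Theory Num.Theory.

Local Open Scope classical_set_scope.
Local Open Scope ring_scope.

(** * The strong law of large numbers *)

(** The strong law gives one null set per integrand, whereas a single null set has to serve all
    parameters of [K] and all thresholds. The law is therefore invoked for countably many integrands
    only: a dense sequence of parameters combined with rational thresholds, indicators at rational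
    thresholds, the absolute values that control a change of threshold, and the envelope [H y * y]
    that controls a change of parameter. What remains is deterministic, on one fixed realization of
    the sample. Pointwise convergence in the threshold is enough because the two sides of the
    minimization are treated differently. At [theta0] the norm must be shown to be small: there the
    empirical functions are bounded uniformly in the sample size and the threshold, and dominated
    convergence applies against the integrable weight. At the limit of the subsequence only a lower
    bound on the norms is wanted. *)

Lemma ge0_sume_const (R : realType) (n : nat) (x : \bar R) :
  (0 <= x -> \sum_(i < n) x = (n%:R)%:E * x)%E.
Proof.
move=> x0; elim: n => [|n ih]; first by rewrite big_ord0 mul0e.
by rewrite big_ord_recr/= ih -natr1 EFinD ge0_muleDl ?lee_fin// mul1e.
Qed.

Section independence.
Context {R : realType} {d : measure_display} {Omega : measurableType d}.
Variables (P : probability Omega R) (Xs : nat -> {RV P >-> R}).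
Hypothesis Xs_indep : mutually_independent Xs.

Lemma independent_pair (i j : nat) (A B : set R) : i != j ->
  measurable A -> measurable B ->
  P (Xs i @^-1` A `&` Xs j @^-1` B) = (P (Xs i @^-1` A) * P (Xs j @^-1` B))%E.
Proof.
move=> ij mA mB.
have := Xs_indep [fset i; j]%fset (A := fun k => if k == i then A else B).
rewrite big_fsetU1 ?inE//= big_seq_fset1 eqxx eq_sym (negbTE ij) => <-; last first.
  by move=> k; case: ifP.
congr (P _); apply/seteqP; split => [w [Aw Bw] k /=|w H].
  by rewrite !inE => /orP[]/eqP->; rewrite ?eqxx// eq_sym (negbTE ij).
split; first by have /= := H i; rewrite !inE eqxx => /(_ isT).
by have /= := H j; rewrite !inE eqxx orbT eq_sym (negbTE ij) => /(_ isT).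
Qed.

(** The joint law of the pair agrees with the product of the two laws on rectangles, hence
    everywhere; Tonelli then splits the integral. *)
Lemma integral_independentM (i j : nat) (f g : R -> \bar R) : i != j ->
  measurable_fun [set: R] f -> measurable_fun [set: R] g ->
  (forall x, 0 <= f x)%E -> (forall x, 0 <= g x)%E ->
  (\int[P]_w (f (Xs i w) * g (Xs j w)) =
   \int[P]_w f (Xs i w) * \int[P]_w g (Xs j w))%E.
Proof.
move=> ij mf mg f0 g0.
have mZ : measurable_fun setT (fun w => (Xs i w, Xs j w)).
  by apply: measurable_fun_pair.
pose Z : {RV P >-> (R * R)%type} := HB.pack (fun w => (Xs i w, Xs j w))
  (isMeasurableFun.Build _ _ _ _ _ mZ).
pose h (z : R * R) := (f z.1 * g z.2)%E.
have mh : measurable_fun setT h.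
  by apply: emeasurable_funM; apply: measurableT_comp.
have h0 z : (0 <= h z)%E by rewrite mule_ge0.
rewrite -(@ge0_integral_distribution _ _ _ _ _ P Z h mh h0).
rewrite (eq_measure_integral (distribution P (Xs i) \x distribution P (Xs j))%E);
  last first.
  move=> A mA _; apply/esym/product_measure_unique => // B C mB mC.
  exact: independent_pair.
rewrite fubini_tonelli1//=.
under eq_integral => x _ do rewrite /fubini_F /h/= ge0_integralZl//.
rewrite ge0_integralZr//=; last exact: integral_ge0.
by rewrite !ge0_integral_distribution.
Qed.

Lemma bounded_Lfun (f : Omega -> R) (c r : R) :
  measurable_fun [set: Omega] f -> (forall w, `|f w| <= c) ->
  0 <= r -> f \in Lfun P r%:E.
Proof.
move=> mf fc r0; rewrite inE; apply/andP; split; rewrite inE//=.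
rewrite /finite_norm unlock poweR_lty//.
apply: (@le_lt_trans _ _ (\int[P]_x (c `^ r)%:E)%E).
  apply: ge0_le_integral => //=.
  - apply/measurable_EFinP.
    apply/(@measurableT_comp _ _ _ _ _ _ (fun x : R => x `^ r)) => //.
    exact/measurableT_comp.
  - move=> x _; rewrite lee_fin ge0_ler_powR ?nnegrE//.
    exact: le_trans (fc x).
by rewrite integral_cst//= probability_setT mule1 ltry.
Qed.

Lemma covariance_independent (f g : R -> R) (c : R) (i j : nat) : i != j ->
  measurable_fun setT f -> measurable_fun setT g ->
  (forall x, 0 <= f x <= c) -> (forall x, 0 <= g x <= c) ->
  covariance P (f \o Xs i) (g \o Xs j) = 0%E.
Proof.
move=> ij mf mg fc gc.
have bf (h : R -> R) : (forall x, 0 <= h x <= c) -> forall x, `|h x| <= c.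
  by move=> hc x; have /andP[h0 ?] := hc x; rewrite ger0_norm.
have L2 (h : R -> R) k : measurable_fun setT h -> (forall x, 0 <= h x <= c) ->
    h \o Xs k \in Lfun P 2%:E.
  move=> mh hc; apply: (@bounded_Lfun _ c) => //; first exact: measurableT_comp.
  by move=> w; exact: (bf h).
rewrite covarianceE; last 3 first.
- by apply: Lfun_subset12; rewrite ?fin_num_measure//; exact: L2.
- by apply: Lfun_subset12; rewrite ?fin_num_measure//; exact: L2.
- by apply: Lfun2_mul_Lfun1; exact: L2.
rewrite !unlock.
under eq_integral do rewrite /= EFinM.
rewrite (@integral_independentM i j (EFin \o f) (EFin \o g))//=.
- by rewrite subee// fin_numM// integrable_fin_num//; apply/Lfun1_integrable;
    apply: Lfun_subset12; rewrite ?fin_num_measure//; exact: L2.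
- exact/measurable_EFinP.
- exact/measurable_EFinP.
- by move=> x; rewrite lee_fin; case/andP: (fc x).
- by move=> x; rewrite lee_fin; case/andP: (gc x).
Qed.

Lemma variance_sum_independent (g : R -> R) (c : R) (k : nat) :
  measurable_fun setT g -> (forall x, 0 <= g x <= c) ->
  'V_P[fun w => \sum_(i < k) g (Xs i w)]%R =
  (\sum_(i < k) 'V_P[g \o Xs i])%E.
Proof.
move=> mg gc.
have gb x : `|g x| <= c by have /andP[h0 ?] := gc x; rewrite ger0_norm.
have mgX i : measurable_fun setT (g \o Xs i) by exact: measurableT_comp.
have L2 i : g \o Xs i \in Lfun P 2%:E.
  by apply: (@bounded_Lfun _ c) => // w; exact: gb.
have L2S n : (fun w => \sum_(i < n) g (Xs i w)) \in Lfun P 2%:E.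
  apply: (@bounded_Lfun _ (n%:R * c)) => //.
    by apply: measurable_sum => i; exact: mgX.
  move=> w; apply: (le_trans (ler_norm_sum _ _ _)).
  by rewrite mulr_natl -[n in leRHS]card_ord -sumr_const ler_sum.
(* Covariance is additive in its first argument, so a partial sum is uncorrelated with every later
   term; this removes the cross term when the sum is extended. *)
have cov0 n j : (n <= j)%N ->
    covariance P (fun w => \sum_(i < n) g (Xs i w)) (g \o Xs j) = 0%E.
  elim: n => [_|n ih nj].
    under eq_fun do rewrite big_ord0.
    exact: covariance_cst_l.
  under eq_fun do rewrite big_ord_recr/=.
  rewrite -[X in covariance _ X]/((fun w => \sum_(i < n) g (Xs i w)) \+ (g \o Xs n)).
  rewrite covarianceDl// ih 1?ltnW// add0e.
  by apply: (@covariance_independent _ _ c) => //; rewrite ltn_eqF.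
elim: k => [|k ih].
  under eq_fun do rewrite big_ord0.
  by rewrite big_ord0; exact: variance_cst.
rewrite big_ord_recr/= -ih -[RHS]adde0.
under eq_fun do rewrite big_ord_recr/=.
rewrite -[X in 'V_P[X]]/((fun w => \sum_(i < k) g (Xs i w)) \+ (g \o Xs k)).
by rewrite varianceD// cov0// mule0.
Qed.

Section identically_distributed.
Variable nu : probability R R.
Hypothesis Xs_law : forall j A, measurable A -> distribution P (Xs j) A = nu A.

Lemma ge0_integral_law (j : nat) (f : R -> \bar R) :
  measurable_fun [set: R] f -> (forall x, 0 <= f x)%E ->
  (\int[P]_w f (Xs j w) = \int[nu]_x f x)%E.
Proof.
move=> mf f0; rewrite -ge0_integral_distribution//.
by apply: eq_measure_integral => A mA _; exact: Xs_law.
Qed.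

(** The left side is the variance of the average, that is [k^-1] times a single variance, which the
    second moment dominates. The factor [k^-1] is kept under the integral so that later sums over
    [k] can be estimated pointwise. *)
Lemma integral_sqr_avg_dev (g : R -> R) (c : R) (k : nat) : (0 < k)%N ->
  measurable_fun setT g -> (forall x, 0 <= g x <= c) ->
  (\int[P]_w ((k%:R^-1 * \sum_(i < k) g (Xs i w)
               - fine (\int[nu]_x (g x)%:E)) ^+ 2)%:E
   <= \int[nu]_x (g x ^+ 2 / k%:R)%:E)%E.
Proof.
move=> k0 mg gc.
have gb x : `|g x| <= c by have /andP[h0 ?] := gc x; rewrite ger0_norm.
have mgX i : measurable_fun setT (g \o Xs i) by exact: measurableT_comp.
have L2 i : g \o Xs i \in Lfun P 2%:E.
  by apply: (@bounded_Lfun _ c) => // w; exact: gb.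
have L1 i : g \o Xs i \in Lfun P 1%:E.
  by apply: (@bounded_Lfun _ c) => // w; exact: gb.
have g0 x : 0 <= g x by case/andP: (gc x).
have kR : k%:R != 0 :> R by rewrite pnatr_eq0 -lt0n.
pose S w := \sum_(i < k) g (Xs i w).
have mS : measurable_fun setT S by apply: measurable_sum => i; exact: mgX.
have Eg i : ('E_P[g \o Xs i] = \int[nu]_x (g x)%:E)%E.
  rewrite unlock -(@ge0_integral_law i (EFin \o g))//=.
  exact/measurable_EFinP.
have Egfin : (\int[nu]_x (g x)%:E)%E \is a fin_num.
  by rewrite -(Eg 0%N) expectation_fin_num.
have ES : ('E_P[S] = (k%:R * fine (\int[nu]_x (g x)%:E))%:E)%E.
  rewrite -[in LHS](_ : \sum_(i < k) (g \o Xs i) = S); last first.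
    by apply/funext => w; rewrite /S fct_sumE.
  rewrite -(big_mkord xpredT (fun i => g \o Xs i)).
  rewrite -(big_map (fun i => g \o Xs i) xpredT id) expectation_sum; last first.
    by move=> _ /mapP[i _ ->].
  rewrite big_map big_mkord (eq_bigr (fun=> \int[nu]_x (g x)%:E)%E)//.
  by rewrite -{1}(fineK Egfin) sumEFin sumr_const card_ord mulr_natl.
have -> : (\int[P]_w ((k%:R^-1 * S w - fine (\int[nu]_x (g x)%:E)) ^+ 2)%:E =
    (k%:R ^-2)%:E * 'V_P[S])%E.
  rewrite /variance unlock ES/= [in RHS]unlock -ge0_integralZl//=.
  - apply: eq_integral => w _; rewrite -EFinM; congr (_ %:E).
    rewrite /= -expr2 -exprVn -exprMn; congr (_ ^+ 2).
    by rewrite mulrBr mulrA mulVf// mul1r.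
  - apply/measurable_EFinP; apply: measurable_funM => //;
      by apply: measurable_funB.
  - by move=> w _; rewrite lee_fin -expr2 sqr_ge0.
rewrite (@variance_sum_independent _ c)//.
have V i : ('V_P[g \o Xs i] <= \int[nu]_x (g x ^+ 2)%:E)%E.
  rewrite varianceE//.
  have -> : ('E_P[(g \o Xs i) ^+ 2] = \int[nu]_x (g x ^+ 2)%:E)%E.
    rewrite unlock -(@ge0_integral_law i (fun x => (g x ^+ 2)%:E))//=.
      by apply/measurable_EFinP; exact: measurable_funX.
    by move=> x; rewrite lee_fin sqr_ge0.
  by rewrite leeBlDl ?leeDr ?sqre_ge0// fin_numX// Eg.
under [leRHS]eq_integral do rewrite mulrC EFinM.
rewrite ge0_integralZl//=; last 2 first.
- by apply/measurable_EFinP; exact: measurable_funX.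
- by move=> x _; rewrite lee_fin sqr_ge0.
rewrite -exprVn expr2 EFinM -muleA lee_wpmul2l ?lee_fin ?invr_ge0//.
rewrite lee_pdivrMl ?ltr0n//.
rewrite -ge0_sume_const; last by apply: integral_ge0 => x _; rewrite lee_fin sqr_ge0.
by apply: lee_sum.
Qed.

End identically_distributed.

End independence.

(** A Borel-Cantelli argument by expectations: the series of the [h n] has finite expectation, hence
    converges almost everywhere, and its terms tend to 0. The bounds [G n] live on the real line so
    that their sum is estimated pointwise by [F] before integrating. *)
Lemma ae_cvg0_of_summable_integral (R : realType) (d : measure_display)
    (Omega : measurableType d) (P : {measure set Omega -> \bar R})
    (nu : {measure set R -> \bar R}) (h : nat -> Omega -> R)
    (G : nat -> R -> R) (F : R -> R) :
  (forall n, measurable_fun setT (h n)) -> (forall n w, 0 <= h n w) ->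
  (forall n, measurable_fun setT (G n)) -> (forall n x, 0 <= G n x) ->
  measurable_fun setT F ->
  (forall n, (\int[P]_w (h n w)%:E <= \int[nu]_x (G n x)%:E)%E) ->
  (forall N x, \sum_(0 <= n < N) G n x <= F x) ->
  (\int[nu]_x (F x)%:E < +oo)%E ->
  {ae P, forall w, h n w @[n --> \oo] --> (0 : R)}.
Proof.
move=> mh h0 mG G0 mF hG GF Foo.
have F0 x : 0 <= F x by have := GF 0%N x; rewrite big_geq.
pose S w := (\sum_(n <oo) (h n w)%:E)%E.
have S0 w : (0 <= S w)%E by apply: nneseries_ge0 => n _ _; rewrite lee_fin.
have mS : measurable_fun setT S.
  apply: ge0_emeasurable_sum => // n; last by move=> _; exact/measurable_EFinP.
  by move=> x _ _; rewrite lee_fin.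
have iS : P.-integrable setT S.
  apply/integrableP; split => //.
  under eq_integral do rewrite gee0_abs//.
  rewrite integral_nneseries//; last 2 first.
  - by move=> n; exact/measurable_EFinP.
  - by move=> n w _; rewrite lee_fin.
  apply: le_lt_trans Foo.
  apply: (@le_trans _ _ (\sum_(n <oo) \int[nu]_x (G n x)%:E)%E).
    by apply: lee_nneseries => // n _ _; apply: integral_ge0 => w _; rewrite lee_fin.
  rewrite -integral_nneseries//; last 2 first.
  - by move=> n; exact/measurable_EFinP.
  - by move=> n w _; rewrite lee_fin.
  apply: ge0_le_integral => //.
  - by move=> x _; apply: nneseries_ge0 => n _ _; rewrite lee_fin.
  - apply: ge0_emeasurable_sum => // n; last by move=> _; exact/measurable_EFinP.
    by move=> x _ _; rewrite lee_fin.
  - exact/measurable_EFinP.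
  - move=> x _; apply: lime_le.
      by apply: is_cvg_nneseries => n _ _; rewrite lee_fin.
    by apply: nearW => N; rewrite sumEFin lee_fin.
have := integrable_ae measurableT iS; apply: filterS => w /(_ I) Sfin.
have tail : (\sum_(n <= k <oo) (h k w)%:E)%E @[n --> \oo] --> 0%E.
  apply: nneseries_tail_cvg; last by move=> k _; rewrite lee_fin.
  by rewrite -ge0_fin_numE// S0.
suff : (h n w)%:E @[n --> \oo] --> 0%:E by move/fine_cvg.
apply: squeeze_cvge; [|exact: cvg_cst|exact: tail].
apply: nearW => n; rewrite lee_fin h0/=.
have := @nneseries_lim_ge R (fun k => (h k w)%:E) xpredT n n.+1.
by rewrite big_nat1; apply => k _; rewrite lee_fin.
Qed.

(** The nonzero terms form a geometric series of ratio 1/2 whose first term is at most [y]. *)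
Lemma sum_truncated_sqr_le (R : realType) (c y : R) (N : nat) : 0 < c -> 0 <= y ->
  \sum_(0 <= n < N) (if y <= c * 2 ^+ n then y ^+ 2 / (c * 2 ^+ n) else 0)
    <= 2 * y.
Proof.
move=> c0 y0.
have cn n : 0 < c * 2 ^+ n by rewrite mulr_gt0// exprn_gt0.
(* The subtracted quantity is the sum of all remaining terms from [N] on; with it the bound passes
   through the induction. *)
have key : \sum_(0 <= n < N) (if y <= c * 2 ^+ n then y ^+ 2 / (c * 2 ^+ n) else 0)
    <= if y <= c * 2 ^+ N then 2 * y - 2 * (y ^+ 2 / (c * 2 ^+ N)) else 0.
  elim: N => [|n ih].
    rewrite big_geq//; case: ifPn => // yc.
    rewrite -mulrBr mulr_ge0// subr_ge0 expr2 -mulrA ler_piMr//.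
    by rewrite ler_pdivrMr// mul1r.
  rewrite big_nat_recr//=; apply: (le_trans (lerD ih (lexx _))).
  have E : c * 2 ^+ n.+1 = 2 * (c * 2 ^+ n) by rewrite exprS mulrCA.
  rewrite E; have := cn n; move: (c * 2 ^+ n) => a a0.
  case: ifPn => [ya|]; first rewrite ifT.
  - have -> : y ^+ 2 / (2 * a) = (y ^+ 2 / a) / 2.
      by rewrite invfM mulrA mulrAC.
    have : 0 <= y ^+ 2 / a by rewrite divr_ge0 ?sqr_ge0// ltW.
    by move: (y ^+ 2 / a) => z z0; lra.
  - by rewrite (le_trans ya)// ler_peMl ?ler1n// ltW.
  - rewrite -ltNge addr0 => ay; case: ifPn => // y2a.
    rewrite -mulrBr mulr_ge0// subr_ge0 expr2 -mulrA ler_piMr//.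
    by rewrite ler_pdivrMr ?mulr_gt0// mul1r.
apply: (le_trans key); case: ifPn => _; last by rewrite mulr_ge0.
by rewrite gerBl mulr_ge0// divr_ge0 ?sqr_ge0// ltW.
Qed.

Lemma sum_dyadic_below_le (R : realType) (c y : R) (N : nat) : 0 < c -> 0 <= y ->
  \sum_(0 <= n < N) (if c * 2 ^+ n < y then c * 2 ^+ n else 0) <= 2 * y.
Proof.
move=> c0 y0.
(* The terms double, so the terms before [n] sum to at most [c * 2 ^+ n]; carrying this second bound
   gives [2 * y] when the next term is still below [y]. *)
suff : \sum_(0 <= n < N) (if c * 2 ^+ n < y then c * 2 ^+ n else 0)
    <= Num.min (c * 2 ^+ N) (2 * y) by rewrite le_min => /andP[].
elim: N => [|n ih].
  by rewrite big_geq// le_min ltW ?mulr_ge0// mulr_gt0.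
rewrite big_nat_recr//=; move: ih; rewrite !le_min => /andP[ih1 ih2].
have E : c * 2 ^+ n.+1 = c * 2 ^+ n + c * 2 ^+ n.
  by rewrite exprS mulrCA mulr_natl mulr2n.
have a0 : 0 <= c * 2 ^+ n by rewrite mulr_ge0 ?exprn_ge0// ltW.
case: ifPn => [ay|_]; last by rewrite addr0 ih2 E (le_trans ih1)// lerDl.
by rewrite E lerD//= mulr_natl mulr2n lerD// ?(le_trans ih1)// ltW.
Qed.

Section strong_law.
Context {R : realType} {d : measure_display} {Omega : measurableType d}.
Variables (P : probability Omega R) (Xs : nat -> {RV P >-> R}).
Hypothesis Xs_indep : mutually_independent Xs.
Variable nu : probability R R.
Hypothesis Xs_law : forall j A, measurable A -> distribution P (Xs j) A = nu A.

(* Etemadi's truncation argument, with the block of length [b * 2 ^ n]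
   truncated at its own length. *)
Lemma strong_law_dyadic (f : R -> R) (b : nat) : (0 < b)%N ->
  measurable_fun setT f -> (forall x, 0 <= f x) ->
  (\int[nu]_x (f x)%:E < +oo)%E ->
  {ae P, forall w, (b * 2 ^ n)%:R^-1 * \sum_(i < b * 2 ^ n) f (Xs i w)
     @[n --> \oo] --> fine (\int[nu]_x (f x)%:E)}.
Proof.
move=> b0 mf f0 foo.
pose k n := (b * 2 ^ n)%N.
have k0 n : (0 < k n)%N by rewrite muln_gt0 b0 expn_gt0.
have kE n : (k n)%:R = b%:R * 2 ^+ n :> R by rewrite natrM natrX.
have bR : 0 < b%:R :> R by rewrite ltr0n.
have intf : nu.-integrable setT (EFin \o f).
  apply/integrableP; split; first exact/measurable_EFinP.
  by under eq_integral do rewrite gee0_abs ?lee_fin//.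
pose g n x := if f x <= (k n)%:R then f x else 0.
have mg n : measurable_fun setT (g n).
  by apply: measurable_fun_ifT => //; exact: measurable_fun_ler.
have g0 n x : 0 <= g n x by rewrite /g; case: ifP.
have gk n x : 0 <= g n x <= (k n)%:R by rewrite g0/= /g; case: ifP.
pose m n := fine (\int[nu]_x (g n x)%:E).
have mK n : measurable_fun setT (fun x => if (k n)%:R < f x then 1 else 0 : R).
  by apply: measurable_fun_ifT => //; exact: measurable_fun_ltr.
have int2f : (\int[nu]_x (2 * f x)%:E < +oo)%E.
  under eq_integral do rewrite EFinM.
  rewrite ge0_integralZl//; first exact: lte_mul_pinfty.
    exact/measurable_EFinP.
  by move=> x _; rewrite lee_fin.
have m2f : measurable_fun setT (fun x => 2 * f x) by exact: measurable_funM.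
(* The averages of the truncated values approach their means: the mean square deviations are
   summable over the dyadic blocks. *)
have cvgA : {ae P, forall w,
    ((k n)%:R^-1 * \sum_(i < k n) g n (Xs i w) - m n) ^+ 2
      @[n --> \oo] --> (0 : R)}.
  apply: (@ae_cvg0_of_summable_integral _ _ _ _ nu _
    (fun n x => g n x ^+ 2 / (k n)%:R) (fun x => 2 * f x)) => //.
  - move=> n; apply: measurable_funX; apply: measurable_funB => //.
    apply: measurable_funM => //; apply: measurable_sum => i.
    exact: measurableT_comp.
  - by move=> n w; exact: sqr_ge0.
  - by move=> n; apply: measurable_funM => //; exact: measurable_funX.
  - by move=> n x; rewrite divr_ge0// sqr_ge0.
  - move=> n; exact: (integral_sqr_avg_dev Xs_indep Xs_law (k0 n) (mg n) (gk n)).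
  - move=> N x; apply: le_trans (sum_truncated_sqr_le N bR (f0 x)).
    apply: ler_sum => n _; rewrite /g kE; case: ifP => // _.
    by rewrite expr0n mul0r.
(* This counts the observations in block [n] that the truncation alters. Its expectation is [k n]
   times the probability that [f] exceeds [k n], again summable over dyadic blocks. *)
have cvgB : {ae P, forall w,
    \sum_(i < k n) (if (k n)%:R < f (Xs i w) then 1 else 0)
      @[n --> \oo] --> (0 : R)}.
  apply: (@ae_cvg0_of_summable_integral _ _ _ _ nu _
    (fun n x => (k n)%:R * (if (k n)%:R < f x then 1 else 0)) (fun x => 2 * f x)) => //.
  - move=> n; apply: measurable_sum => i.
    exact: (measurableT_comp (mK n)).
  - by move=> n w; apply: sumr_ge0 => i _; case: ifP.
  - by move=> n; exact: measurable_funM.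
  - by move=> n x; case: ifP; rewrite ?mulr1 ?mulr0.
  - move=> n.
    under eq_integral do rewrite -sumEFin.
    rewrite ge0_integral_sum//; last 2 first.
    + by move=> i; apply/measurable_EFinP; exact: (measurableT_comp (mK n)).
    + by move=> i w _; rewrite lee_fin; case: ifP.
    rewrite (eq_bigr (fun=> \int[nu]_x (if (k n)%:R < f x then 1 else 0)%:E)%E);
      last first.
      move=> i _; rewrite -(ge0_integral_law Xs_law i)//.
        exact/measurable_EFinP.
      by move=> x; rewrite lee_fin; case: ifP.
    under [leRHS]eq_integral do rewrite EFinM.
    rewrite ge0_integralZl//; last 2 first.
    + exact/measurable_EFinP.
    + by move=> x _; rewrite lee_fin; case: ifP.
    rewrite ge0_sume_const//.
    by apply: integral_ge0 => x _; rewrite lee_fin; case: ifP.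
  - move=> N x; apply: le_trans (sum_dyadic_below_le N bR (f0 x)).
    apply: ler_sum => n _; rewrite kE.
    by case: ifP => _; rewrite ?mulr1 ?mulr0.
have kn n : (n%:R <= (k n)%:R :> R).
  rewrite ler_nat (leq_trans (ltnW (ltn_expl n (ltnSn 1))))//.
  by rewrite leq_pmull.
have cvgm : m n @[n --> \oo] --> fine (\int[nu]_x (f x)%:E).
  apply: fine_cvg; rewrite fineK; last first.
    by apply: integrable_fin_num.
  apply: (@dominated_cvg _ _ _ nu setT measurableT (fun n x => (g n x)%:E)
    (fun x => (f x)%:E) (fun x => (f x)%:E)) => //.
  - by move=> n; exact/measurable_EFinP.
  - move=> x _; apply: cvg_near_cst.
    near=> n; rewrite /g ifT//; apply: le_trans (kn n).
    by near: n; exact: nbhs_infty_ger.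
  - move=> n x _; rewrite gee0_abs ?lee_fin// /g; case: ifP => //.
move: cvgA cvgB; apply: filterS2 => w Aw Bw.
have {}Aw : (k n)%:R^-1 * \sum_(i < k n) g n (Xs i w) - m n @[n --> \oo] --> (0 : R).
  apply/norm_cvg0P.
  have : Num.sqrt (((k n)%:R^-1 * \sum_(i < k n) g n (Xs i w) - m n) ^+ 2)
      @[n --> \oo] --> Num.sqrt (0 : R).
    by apply: (continuous_cvg _ _ Aw); exact: sqrt_continuous.
  by rewrite sqrtr0; under eq_fun do rewrite sqrtr_sqr.
rewrite -[X in _ --> X]add0r; refine (cvg_trans _ (cvgD Aw cvgm)).
apply: near_eq_cvg; near=> n; rewrite /= subrK -/(k n); congr (_ * _).
(* A sum of zeros and ones below 1 vanishes, so from some block on the truncation changes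
   nothing. *)
have lt1 : \sum_(i < k n) (if (k n)%:R < f (Xs i w) then 1 else 0) < 1 :> R.
  by near: n; exact: (cvgr_lt _ Bw _ ltr01).
apply: eq_bigr => i _; rewrite /g; case: ifPn => //; rewrite -ltNge => ki.
move: lt1; rewrite (bigD1 i)//= ki ltNge lerDl sumr_ge0// => j _.
by case: ifP.
Unshelve. all: end_near. Qed.

End strong_law.

(* Every large [m] lies between [b * 2 ^ n] and [b.+1 * 2 ^ n] for some
   [B <= b < 2 * B], so these two numbers have ratio at most [1 + 1 / B]. *)
Lemma cvg_avg_dyadic (R : realType) (a : nat -> R) (L : R) :
  (forall i, 0 <= a i) ->
  (forall b, (0 < b)%N -> (b * 2 ^ n)%:R^-1 * \sum_(i < b * 2 ^ n) a i
     @[n --> \oo] --> L) ->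
  n%:R^-1 * \sum_(i < n) a i @[n --> \oo] --> L.
Proof.
move=> a0 aL; pose S n := \sum_(i < n) a i.
have Smono m n : (m <= n)%N -> S m <= S n.
  move=> mn; rewrite /S -(subnKC mn) big_split_ord/= lerDl.
  exact: sumr_ge0.
have S0 n : 0 <= S n by exact: sumr_ge0.
have L0 : 0 <= L.
  apply: (cvgr_to_ge (aL 1%N isT)).
  by apply: nearW => n; rewrite mulr_ge0 ?invr_ge0// sumr_ge0.
apply/cvgrPdist_le => e e0.
(* The tolerance is split in two: [eta] for the deviation of the block averages from [L], and
   [(L + 1) / B] for the error of comparing [m] with its neighbouring blocks; [eta <= 1] keeps those
   averages below [L + 1]. *)
pose eta : R := Num.min 1 (e / 2).
have eta0 : 0 < eta by rewrite lt_min ltr01 divr_gt0.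
have eta1 : eta <= 1 by rewrite ge_min lexx.
have etae : eta <= e / 2 by rewrite ge_min lexx orbT.
pose B := (Num.bound (2 * (L + 1) / e)).+1.
have B0 : (0 < B)%N by [].
have BL : (L + 1) / B%:R <= e / 2.
  have : 2 * (L + 1) / e <= B%:R.
    rewrite /B -natr1 (le_trans (ltW (archi_boundP _))) ?ler_nat//.
    by rewrite divr_ge0 ?mulr_ge0 ?addr_ge0// ltW.
  rewrite ler_pdivrMr// => h; rewrite ler_pdivrMr ?ltr0n// mulrAC.
  by rewrite ler_pdivlMr// mulrC (le_trans h)// mulrC.
(* Only finitely many [b] occur, so one rank serves them all; the range includes [2 * B] because
   [b.+1] may reach it. *)
have near_b : \forall n \near \oo, forall b : 'I_(2 * B).+1, (0 < b)%N ->
    `|L - (b * 2 ^ n)%:R^-1 * S (b * 2 ^ n)%N| <= eta.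
  apply: filter_forall => b; have [->|b0] := posnP b; first exact: nearW.
  by have /cvgrPdist_le/(_ _ eta0) := aL b b0; apply: filterS.
case: near_b => N _ HN.
near=> m.
have mB : (B * 2 ^ N <= m)%N by near: m; exact: nbhs_infty_ge.
(* The power [2 ^ n] is the largest one with [B * 2 ^ n <= m], which forces [B <= b < 2 * B]. *)
pose r := (m %/ B)%N; pose n := trunc_log 2 r; pose b := (m %/ 2 ^ n)%N.
have rN : (2 ^ N <= r)%N by rewrite leq_divRL// mulnC.
have r0 : (0 < r)%N by rewrite (leq_trans _ rN)// expn_gt0.
have /andP[nr rn] := trunc_log_bounds (isT : (1 < 2)%N) r0.
have Nn : (N <= n)%N by exact: trunc_log_max.
have n0 : (0 < 2 ^ n)%N by rewrite expn_gt0.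
have Bb : (B <= b)%N.
  by rewrite leq_divRL// (leq_trans (leq_mul (leqnn B) nr))// mulnC leq_trunc_div.
have b2B : (b < 2 * B)%N.
  by rewrite ltn_divLR// mulnAC -expnS -ltn_divLR.
have bm : (b * 2 ^ n <= m)%N by exact: leq_trunc_div.
have mb : (m <= b.+1 * 2 ^ n)%N by rewrite ltnW// -ltn_divLR.
have b0 : (0 < b)%N by exact: leq_trans Bb.
have b2B' : (b < (2 * B).+1)%N by exact: leq_trans b2B _.
have b2B'' : (b.+1 < (2 * B).+1)%N by [].
have := HN n Nn (Ordinal b2B') b0.
have := HN n Nn (Ordinal b2B'') isT.
rewrite /= -/S !natrM natrX => H1 H2.
have m0 : (0 < m)%N by rewrite (leq_trans _ bm)// muln_gt0 b0.
have u0 : 0 < 2 ^+ n :> R by rewrite exprn_gt0.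
have bR : 0 < b%:R :> R by rewrite ltr0n.
have BbR : B%:R <= b%:R :> R by rewrite ler_nat.
have mR : 0 < m%:R :> R by rewrite ltr0n.
have bmR : b%:R * 2 ^+ n <= m%:R :> R by rewrite -natrX -natrM ler_nat.
have mbR : m%:R <= b.+1%:R * 2 ^+ n :> R by rewrite -natrX -natrM ler_nat.
have BR : 0 < B%:R :> R by rewrite ltr0n.
have := Smono _ _ bm; have := Smono _ _ mb.
rewrite -/(S m).
move: (S (b * 2 ^ n)%N) (S (b.+1 * 2 ^ n)%N) (S0 (b * 2 ^ n)%N) (S0 (b.+1 * 2 ^ n)%N)
  (S m) H1 H2 => Sb Sb1 Sb0 Sb10 Sm H1 H2 Smb1 Sbm.
have b1R : 0 < b.+1%:R :> R by rewrite ltr0n.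
set A1 := (_ * Sb1) in H1; set A0 := (_ * Sb) in H2.
have A10 : 0 <= A1 by rewrite mulr_ge0// invr_ge0 mulr_ge0// ltW.
have A00 : 0 <= A0 by rewrite mulr_ge0// invr_ge0 mulr_ge0// ltW.
have E1 : Sb1 = b.+1%:R * 2 ^+ n * A1 by rewrite mulrA divff ?mul1r// mulf_neq0// gt_eqF.
have E0 : Sb = b%:R * 2 ^+ n * A0 by rewrite mulrA divff ?mul1r// mulf_neq0// gt_eqF.
have hi : m%:R^-1 * Sm <= A1 + A1 / b%:R.
  rewrite ler_pdivrMl// (le_trans Smb1)// E1.
  have -> : A1 + A1 / b%:R = b.+1%:R / b%:R * A1.
    by rewrite -natr1; field; rewrite gt_eqF.
  have -> : b.+1%:R * 2 ^+ n * A1 = b%:R * 2 ^+ n * (b.+1%:R / b%:R * A1).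
    by field; rewrite gt_eqF.
  by rewrite ler_wpM2r// mulr_ge0// divr_ge0.
have lo : A0 - A0 / b%:R <= m%:R^-1 * Sm.
  rewrite ler_pdivlMl// (le_trans _ Sbm)// E0.
  have -> : A0 - A0 / b%:R = (b%:R - 1) / b%:R * A0 by field; rewrite gt_eqF.
  rewrite mulrA ler_wpM2r// (@le_trans _ _ (b.+1%:R * 2 ^+ n * ((b%:R - 1) / b%:R)))//.
    by rewrite ler_wpM2r// divr_ge0// ?subr_ge0 ?ler1n// ltW.
  (* What is left is [(b + 1) * (b - 1) <= b ^ 2]. *)
  rewrite mulrAC ler_pM2r// mulrA ler_pdivrMr// -natr1.
  by nra.
have A1L : A1 / b%:R <= (L + 1) / B%:R.
  apply: ler_pM => //; rewrite ?invr_ge0// ?lef_pV2 ?posrE//.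
  by move: H1; rewrite ler_distlC => /andP[_ ?]; lra.
have A0L : A0 / b%:R <= (L + 1) / B%:R.
  apply: ler_pM => //; rewrite ?invr_ge0// ?lef_pV2 ?posrE//.
  by move: H2; rewrite ler_distlC => /andP[_ ?]; lra.
move: H1 H2; rewrite !ler_distlC => /andP[? ?] /andP[? ?].
by apply/andP; split; lra.
Unshelve. all: end_near. Qed.

Section strong_law.
Context {R : realType} {d : measure_display} {Omega : measurableType d}.
Variables (P : probability Omega R) (Xs : nat -> {RV P >-> R}).
Hypothesis Xs_indep : mutually_independent Xs.
Variable nu : probability R R.
Hypothesis Xs_law : forall j A, measurable A -> distribution P (Xs j) A = nu A.

Lemma ge0_strong_law (f : R -> R) :
  measurable_fun setT f -> (forall x, 0 <= f x) ->
  (\int[nu]_x (f x)%:E < +oo)%E ->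
  {ae P, forall w, n%:R^-1 * \sum_(i < n) f (Xs i w)
     @[n --> \oo] --> fine (\int[nu]_x (f x)%:E)}.
Proof.
move=> mf f0 foo.
have /ae_foralln := fun b => strong_law_dyadic Xs_indep Xs_law (ltn0Sn b) mf f0 foo.
apply: filterS => w H.
by apply: (@cvg_avg_dyadic _ (fun i => f (Xs i w))) => [i|[//|b] _]; [exact: f0|exact: H].
Qed.

Theorem strong_law (f : R -> R) :
  nu.-integrable setT (EFin \o f) ->
  {ae P, forall w, n%:R^-1 * \sum_(i < n) f (Xs i w)
     @[n --> \oo] --> \int[nu]_x f x}.
Proof.
move=> intf.
have mf : measurable_fun setT f.
  by apply/measurable_EFinP; exact: measurable_int intf.
have ip := integrable_funrpos measurableT intf.
have im := integrable_funrneg measurableT intf.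
have := ge0_strong_law (measurable_funrpos mf) (funrpos_ge0 f) (integrable_lty measurableT ip).
have := ge0_strong_law (measurable_funrneg mf) (funrneg_ge0 f) (integrable_lty measurableT im).
apply: filterS2 => w Hn Hp.
have -> : \int[nu]_x f x = \int[nu]_x f^\+ x - \int[nu]_x f^\- x.
  rewrite -RintegralB//; apply: eq_Rintegral => x _.
  by rewrite -[in LHS](funrposBneg f).
refine (cvg_trans _ (cvgB Hp Hn)); apply: near_eq_cvg; apply: nearW => n /=.
rewrite -[LHS]mulrBr -sumrB; congr (_ * _); apply: eq_bigr => i _.
by rewrite -[in RHS](funrposBneg f).
Qed.

End strong_law.

(** * Stein functions of densities on the half-line *)

Section positive_half_line.
Context {R : realType}.
Local Notation mu := (@lebesgue_measure R).
Local Notation half := (`]0%R, +oo[%classic : set R).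

Lemma measurable_fun_pos_continuous (f : R -> R) :
  (forall x : R, 0 < x -> {for x, continuous f}) -> measurable_fun half f.
Proof.
move=> fc; apply: open_continuous_measurable_fun; first exact: interval_open.
by move=> x; rewrite inE/= in_itv/= andbT; exact: fc.
Qed.

Lemma eq_of_derive_cst (F : R -> R) (c x y : R) : 0 < x -> 0 < y ->
  (forall z : R, 0 < z -> is_derive z (1 : R) F c) -> F y - F x = c * (y - x).
Proof.
wlog xy : x y / x <= y.
  move=> H; case: (leP x y) => [/H//|/ltW yx] x0 y0 Fc.
  by rewrite -opprB (H _ _ yx y0 x0 Fc) -mulrN opprB.
move=> x0 y0 Fc.
have := @MVT_segment R F (fun=> c) x y xy; case.
- by move=> z; rewrite in_itv/= => /andP[xz _]; apply: Fc; exact: lt_trans xz.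
- apply: derivable_within_continuous => z; rewrite in_itv/= => /andP[xz _].
  by have [] := Fc z (lt_le_trans x0 xz).
- by move=> z _ ->.
Qed.

Lemma derive_cst_bounded_eq0 (F : R -> R) (c M : R) :
  (forall z : R, 0 < z -> is_derive z (1 : R) F c) ->
  (forall z : R, 0 < z -> `|F z| <= M) -> c = 0.
Proof.
move=> Fc FM; apply/eqP; case: eqP => // /eqP c0; exfalso.
have M0 : 0 <= M by rewrite (le_trans _ (FM 1 ltr01)).
have c1 : 0 < `|c| by rewrite normr_gt0.
(* At this point the increment [|c| * (y - 1)] equals [2 * M + 1], more than two values bounded by
   [M] can differ. *)
pose y := 1 + (2 * M + 1) / `|c|.
have y1 : 1 < y by rewrite ltrDl divr_gt0// ltr_pwDr// mulr_ge0.
have y0 : 0 < y by exact: lt_trans y1.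
have := eq_of_derive_cst ltr01 y0 Fc.
move/(congr1 Num.norm); rewrite normrM [y - 1]addrC addKr.
rewrite (@ger0_norm _ (_ / _)); last by rewrite divr_ge0// addr_ge0// mulr_ge0.
rewrite mulrC divfK ?gt_eqF// => H.
have : `|F y - F 1| <= M + M by rewrite (le_trans (ler_normB _ _))// lerD ?FM.
by rewrite H; lra.
Qed.

Lemma is_derive_integral (f : R -> R) (a : itv_bound R) (x u : R) : x < u ->
  mu.-integrable [set` Interval a (BRight u)] (EFin \o f) ->
  (a < BRight x)%E -> {for x, continuous f} ->
  is_derive x (1 : R)
    (fun y => \int[mu]_(t in [set` Interval a (BRight y)]) f t) (f x).
Proof.
move=> xu intf ax fx; have [dF <-] := continuous_FTC1 xu intf ax fx.
by rewrite derive1E; exact: derivableP.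
Qed.

(** A nonzero value would persist on a ball, which has positive measure but would lie in a null
    set. *)
Lemma ae_eq0_continuous (F : R -> R) :
  {ae mu, forall t, 0 < t -> F t = 0} ->
  (forall t : R, 0 < t -> {for t, continuous F}) ->
  forall t, 0 < t -> F t = 0.
Proof.
move=> [N [mN N0 FN]] Fc t t0; apply/eqP; case: eqP => // /eqP Ft; exfalso.
have : \forall y \near t, 0 < y /\ F y != 0.
  near=> y; split; first by near: y; exact: lt_nbhsr.
  rewrite -normr_gt0; near: y.
  have : `|F y| @[y --> t] --> `|F t| by apply: cvg_norm; exact: Fc.
  by move/cvgr_gt; apply; rewrite normr_gt0.
move=> /nbhs_ballP[e /= e0 tF].
have : (mu (ball t e) <= mu N)%E.
  apply: le_measure; rewrite ?inE//; first exact: measurable_ball.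
  apply: subset_trans FN => y /tF[y0 /eqP Fy] /=; exact/not_implyP.
rewrite N0 lebesgue_measure_ball; last exact: ltW.
rewrite (_ : 0%E = 0%:E)// lee_fin leNgt.
by rewrite pmulrn_lgt0 ?e0.
Unshelve. all: end_near. Qed.

Section stein.
Variables (g f : R -> R).
Hypothesis gc : forall x : R, 0 < x -> {for x, continuous g}.
Hypothesis gint : mu.-integrable half (fun x => (x * g x)%:E).
Hypothesis fc : forall x : R, 0 < x -> {for x, continuous f}.
Hypothesis fint : mu.-integrable setT (EFin \o f).
Hypothesis f0 : forall x, x <= 0 -> f x = 0.

(** This is F of the overview, with [f] the true density and [g] the product of the candidate score
    and [f], so that expectations become Lebesgue integrals; [upper_tail] is G. *)
Definition stein_fun (t : R) : R :=
  \int[mu]_(x in half) (g x * Num.min x t) + distribution_function f t.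

Definition upper_tail (t : R) : R := \int[mu]_(x in `]t, +oo[) g x.

Let mg : measurable_fun half g. Proof. exact: measurable_fun_pos_continuous. Qed.

(** Only [x * g x] is assumed integrable, which says little about [g] near 0; beyond [a] the factor
    [x / a] exceeds 1 and dominates. *)
Let integrable_tail (a : R) : 0 < a -> mu.-integrable `]a, +oo[ (EFin \o g).
Proof.
move=> a0; apply: (@le_integrable _ _ _ mu _ _ _ (fun x => (a^-1)%:E * (x * g x)%:E)%E) => //.
- apply/measurable_EFinP; apply: measurable_funS mg => //.
  by apply: subset_itvr; rewrite bnd_simp ltW.
- move=> x /=; rewrite in_itv/= andbT => ax; have x0 := lt_trans a0 ax.
  rewrite lee_fin mulrA normrM ler_peMl// ger0_norm ?mulr_ge0 ?invr_ge0 ?ltW//.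
  by rewrite mulrC ltr_pdivlMr// mul1r.
- apply: integrableZl => //; apply: integrableS gint => //.
  by apply: subset_itvr; rewrite bnd_simp ltW.
Qed.

Let min_bound x t : 0 < x -> 0 < t -> `|g x * Num.min x t| <= `|x * g x|.
Proof.
move=> x0 t0; rewrite !normrM mulrC ler_wpM2r//.
by rewrite (gtr0_norm x0) ger0_norm ?ge_min ?lexx// le_min !ltW.
Qed.

Lemma integrable_min (t : R) : 0 < t ->
  mu.-integrable half (EFin \o (fun x => g x * Num.min x t)).
Proof.
move=> t0; apply: (le_integrable _ _ _ gint) => //.
- apply/measurable_EFinP; apply: measurable_funM => //.
  by apply: measurable_minr.
- move=> x /=; rewrite in_itv/= andbT => x0; rewrite lee_fin; exact: min_bound.
Qed.

(** After the split, [t] occurs only as an endpoint and as a factor, which is the form that the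
    fundamental theorem of calculus can differentiate. *)
Lemma integral_min_split (t : R) : 0 < t ->
  \int[mu]_(x in half) (g x * Num.min x t) =
  \int[mu]_(x in `]0, t]) (x * g x) + t * upper_tail t.
Proof.
move=> t0; have /(Rintegral_itvB (integrable_min t0)) : (BRight 0 <= BRight t)%O.
  by rewrite bnd_simp ltW.
move=> /(_ isT)/eqP; rewrite subr_eq addrC => /eqP ->; congr (_ + _).
  apply: eq_Rintegral => x; rewrite inE/= in_itv/= => /andP[_ xt].
  by rewrite min_l// mulrC.
rewrite -RintegralZl//; last exact: integrable_tail.
apply: eq_Rintegral => x; rewrite inE/= in_itv/= andbT => /ltW tx.
by rewrite min_r// mulrC.
Qed.

Lemma upper_tailB (a t : R) : 0 < a -> a <= t ->
  upper_tail t = upper_tail a - \int[mu]_(x in `]a, t]) g x.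
Proof.
by move=> a0 at_; rewrite /upper_tail (Rintegral_itvB (integrable_tail a0)).
Qed.

Lemma is_derive_upper_tail (t : R) : 0 < t ->
  is_derive t (1 : R) upper_tail (- g t).
Proof.
(* The tail is compared with an integral from a fixed point [a] below [t], so that the variable
   becomes an upper endpoint. *)
move=> t0; pose a := t / 2.
have a0 : 0 < a by rewrite divr_gt0.
have at_ : a < t by rewrite /a; lra.
pose B y := \int[mu]_(x in `]a, y]) g x.
have dB : is_derive t (1 : R) B (g t).
  apply: (@is_derive_integral _ _ _ (t + 1)); last exact: gc.
  - by rewrite ltrDl.
  - by apply: integrableS (integrable_tail a0) => //; exact: subset_itvl.
  - by rewrite lte_fin.
apply: (@near_eq_is_derive _ _ _ (cst (upper_tail a) - B)).
  near=> y; rewrite /= (@upper_tailB a y)//.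
  by apply/ltW; near: y; exact: lt_nbhsr.
by rewrite -[X in is_derive _ _ _ X]sub0r; exact: is_deriveB.
Unshelve. all: end_near. Qed.

Lemma is_derive_distribution_function (t : R) : 0 < t ->
  is_derive t (1 : R) (distribution_function f) (f t).
Proof.
move=> t0; apply: (@is_derive_integral _ _ _ (t + 1)); last exact: fc.
- by rewrite ltrDl.
- exact: integrableS fint.
- by rewrite ltNyr.
Qed.

Lemma is_derive_stein_fun (t : R) : 0 < t ->
  is_derive t (1 : R) stein_fun (upper_tail t + f t).
Proof.
move=> t0.
pose A y := \int[mu]_(x in `]0, y]) (x * g x).
have dA : is_derive t (1 : R) A (t * g t).
  apply: (@is_derive_integral _ _ _ (t + 1)).
  - by rewrite ltrDl.
  - by apply: integrableS gint => //; exact: subset_itvl.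
  - by rewrite lte_fin.
  - by apply: continuousM => //; exact: gc.
apply: (@near_eq_is_derive _ _ _ (A + (id * upper_tail) + distribution_function f)).
  near=> y; rewrite /stein_fun integral_min_split//.
  by near: y; exact: lt_nbhsr.
(* The term [t * g t] from the moving endpoint cancels against the derivative of the tail. *)
have -> : upper_tail t + f t =
    t * g t + (t *: - g t + upper_tail t *: 1) + f t.
  by rewrite /GRing.scale/=; ring.
apply: is_deriveD; last exact: is_derive_distribution_function.
apply: is_deriveD => //.
by apply: is_deriveM; exact: is_derive_upper_tail.
Unshelve. all: end_near. Qed.

Let integrable_restrict (t : R) : mu.-integrable setT (EFin \o f \_ `]-oo, t]).
Proof.
rewrite -restrict_EFin; apply: (integrable_mkcond _ _).1 => //.
exact: integrableS fint.
Qed.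

Lemma stein_fun_bounded : exists M : R, forall t : R, 0 < t -> `|stein_fun t| <= M.
Proof.
exists (\int[mu]_(x in half) `|x * g x| + \int[mu]_x `|f x|) => t t0.
rewrite (le_trans (ler_normD _ _))// lerD//.
  apply: (le_trans (le_normr_Rintegral _ (integrable_min t0))) => //.
  apply: le_Rintegral => //.
  - exact: integrable_norm (integrable_min t0).
  - exact: integrable_norm gint.
  - by move=> x /=; rewrite in_itv/= andbT => x0; exact: min_bound.
rewrite /distribution_function Rintegral_mkcond.
have fi := integrable_restrict t.
apply: (le_trans (le_normr_Rintegral _ fi)) => //.
apply: le_Rintegral => //.
- exact: integrable_norm fi.
- exact: integrable_norm fint.
- by move=> x _; rewrite patchE; case: ifP => // _; rewrite normr0.
Qed.

Lemma stein_fun_cvg0 : stein_fun n.+1%:R^-1 @[n --> \oo] --> (0 : R).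
Proof.
have n0 n : 0 < n.+1%:R^-1 :> R by rewrite invr_gt0.
have H1 : \int[mu]_(x in half) (g x * Num.min x n.+1%:R^-1) @[n --> \oo] --> (0 : R).
  apply: fine_cvg; rewrite -[X in _ --> X](@integral0 _ _ _ mu half).
  apply: (@dominated_cvg _ _ _ mu half _ _ _ (fun x => `|(x * g x)%:E|%E)) => //.
  - by move=> n; have /integrableP[] := integrable_min (n0 n).
  - move=> x /=; rewrite in_itv/= andbT => x0.
    apply: cvg_EFin; first exact: nearW.
    have : Num.min x n.+1%:R^-1 @[n --> \oo] --> (0 : R).
      apply: squeeze_cvgr; [|exact: cvg_cst|exact: cvg_harmonic].
      by apply: nearW => n; rewrite le_min (ltW x0) (ltW (n0 n))/= ge_min lexx orbT.
    move=> /(cvgM (cvg_cst (g x))); rewrite mulr0; exact.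
  - exact: integrable_abse gint.
  - move=> n x /=; rewrite in_itv/= andbT => x0; rewrite lee_fin; exact: min_bound.
have H2 : distribution_function f n.+1%:R^-1 @[n --> \oo] --> (0 : R).
  rewrite /distribution_function; under eq_fun do rewrite Rintegral_mkcond.
  apply: fine_cvg; rewrite -[X in _ --> X](@integral0 _ _ _ mu setT).
  apply: (@dominated_cvg _ _ _ mu setT _ _ _ (fun x => `|(f x)%:E|%E)) => //.
  - by move=> n; have /integrableP[] := integrable_restrict n.+1%:R^-1.
  - move=> x _; apply: cvg_near_cst.
    have [x0|x0] := leP x 0.
      by apply: nearW => n; rewrite patchE f0//; case: ifP.
    have /cvgr_lt/(_ _ x0) := @cvg_harmonic R; apply: filterS => n nx.
    by rewrite patchE memNset//= in_itv/= leNgt nx.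
  - exact: integrable_abse fint.
  - by move=> n x _; rewrite patchE; case: ifP => //= _; rewrite normr0 lee_fin.
by rewrite -[X in _ --> X]addr0; exact: cvgD.
Qed.

(** The derivative [upper_tail + f] has derivative [- g + g = 0], so the Stein function is affine;
    boundedness kills its slope and the limit at 0 its constant term. *)
Lemma stein_identity : (forall x : R, 0 < x -> is_derive x (1 : R) f (g x)) ->
  forall t : R, 0 < t -> stein_fun t = 0.
Proof.
move=> fg.
have [M FM] := stein_fun_bounded.
pose c := upper_tail 1 + f 1.
have D (y : R) : 0 < y -> is_derive y (1 : R) (upper_tail + f) 0.
  move=> y0; rewrite -(addNr (g y)); apply: is_deriveD; last exact: fg.
  exact: is_derive_upper_tail.
have cE (z : R) : 0 < z -> upper_tail z + f z = c.
  move=> z0; have /eqP := eq_of_derive_cst ltr01 z0 D.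
  by rewrite mul0r subr_eq0 => /eqP.
have Fc (z : R) : 0 < z -> is_derive z (1 : R) stein_fun c.
  by move=> z0; rewrite -(cE z z0); exact: is_derive_stein_fun.
have c0 := derive_cst_bounded_eq0 Fc FM.
rewrite c0 in Fc => t t0.
have : stein_fun n.+1%:R^-1 @[n --> \oo] --> stein_fun t.
  apply: cvg_near_cst; apply: nearW => n.
  have n0 : 0 < n.+1%:R^-1 :> R by rewrite invr_gt0.
  by have /eqP := eq_of_derive_cst t0 n0 Fc; rewrite mul0r subr_eq0 => /eqP.
by move=> /cvg_unique/(_ stein_fun_cvg0); apply; exact: Rhausdorff.
Qed.

(** Continuity upgrades the hypothesis to every [t > 0]. Then the derivative vanishes as well, so
    [f] equals [- upper_tail], and it inherits the derivative [g] from there. *)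
Lemma stein_characterization : {ae mu, forall t, 0 < t -> stein_fun t = 0} ->
  forall x : R, 0 < x -> is_derive x (1 : R) f (g x).
Proof.
move=> F0.
have Fc (t : R) : 0 < t -> {for t, continuous stein_fun}.
  move=> t0; apply: differentiable_continuous; apply/derivable1_diffP.
  by have [] := is_derive_stein_fun t0.
have FE (t : R) : 0 < t -> stein_fun t = 0 by exact: ae_eq0_continuous.
have fE (t : R) : 0 < t -> f t = - upper_tail t.
  move=> t0; have := is_derive_stein_fun t0.
  have : is_derive t (1 : R) stein_fun 0.
    apply: (@near_eq_is_derive _ _ _ (cst 0)).
    near=> y; rewrite /= FE//.
    by near: y; exact: lt_nbhsr.
  move=> [_ D0] [_]; rewrite D0 => /esym/eqP.
  by rewrite addrC addr_eq0 => /eqP.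
move=> x x0; rewrite -(opprK (g x)).
apply: (@near_eq_is_derive _ _ _ (- upper_tail)).
  near=> y; rewrite fE//.
  by near: y; exact: lt_nbhsr.
by apply: is_deriveN; exact: is_derive_upper_tail.
Unshelve. all: end_near. Qed.

End stein.
End positive_half_line.

(** * Integration against a density *)

(** [h] agrees almost everywhere with the Radon-Nikodym derivative, since both have the same
    integral over every measurable set. *)
Lemma ge0_integral_density (d : measure_display) (T : measurableType d)
    (R : realType) (nu : {finite_measure set T -> \bar R})
    (mu : {sigma_finite_measure set T -> \bar R}) (h f : T -> \bar R) :
  mu.-integrable setT h ->
  (forall A, measurable A -> nu A = \int[mu]_(x in A) h x)%E ->
  measurable_fun setT f -> (forall x, 0 <= f x)%E ->
  (\int[nu]_x f x = \int[mu]_x (f x * h x))%E.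
Proof.
move=> inth nuE mf f0.
have numu : nu `<< mu.
  apply/null_content_dominatesP => A mA A0; rewrite nuE//.
  apply: null_set_integral => //.
  by apply: measurable_funTS; exact: measurable_int inth.
rewrite -(Radon_Nikodym_SigmaFinite.change_of_variables numu)//.
have mRN := Radon_Nikodym_SigmaFinite.f_integrable numu.
apply: ae_eq_integral => //.
- by apply: emeasurable_funM => //; exact: measurable_int mRN.
- by apply: emeasurable_funM => //; exact: measurable_int inth.
- apply: ae_eqe_mul2l; apply: integral_ae_eq => //.
    exact: measurable_int inth.
  by move=> A _ mA; rewrite -Radon_Nikodym_SigmaFinite.f_integral// nuE.
Qed.

Section density.
Context {R : realType} (d : measure_display) (T : measurableType d).
Variables (nu : {finite_measure set T -> \bar R}).
Variables (mu : {sigma_finite_measure set T -> \bar R}) (h : T -> R).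
Hypothesis inth : mu.-integrable setT (EFin \o h).
Hypothesis h0 : forall x, 0 <= h x.
Hypothesis nuE :
  (forall A, measurable A -> nu A = \int[mu]_(x in A) (h x)%:E)%E.

Lemma integrable_density (f : T -> R) : nu.-integrable setT (EFin \o f) ->
  mu.-integrable setT (EFin \o (fun x => f x * h x)).
Proof.
move=> /integrableP[/measurable_EFinP mf foo]; apply/integrableP; split.
  apply/measurable_EFinP; apply: measurable_funM => //.
  exact/measurable_EFinP/(measurable_int _ inth).
apply: le_lt_trans foo.
rewrite (ge0_integral_density inth)//; last first.
  by apply: measurableT_comp => //; exact/measurable_EFinP.
apply: ge0_le_integral => //=.
- apply/measurable_EFinP; apply: measurableT_comp => //.
  by apply: measurable_funM => //; exact/measurable_EFinP/(measurable_int _ inth).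
- apply: emeasurable_funM; last exact: measurable_int inth.
  by apply/measurable_EFinP; apply: measurableT_comp.
- by move=> x _; rewrite -EFinM lee_fin normrM (ger0_norm (h0 x)).
Qed.

Lemma Rintegral_density (f : T -> R) : nu.-integrable setT (EFin \o f) ->
  \int[nu]_x f x = \int[mu]_x (f x * h x).
Proof.
have ge0 (g : T -> R) : (forall x, 0 <= g x) -> nu.-integrable setT (EFin \o g) ->
    \int[nu]_x g x = \int[mu]_x (g x * h x).
  move=> g0 intg; congr fine; rewrite (ge0_integral_density inth)//.
  exact: measurable_int intg.
move=> intf.
have ip := integrable_funrpos measurableT intf.
have im := integrable_funrneg measurableT intf.
have -> : \int[nu]_x f x = \int[nu]_x (f^\+ x - f^\- x).
  by apply: eq_Rintegral => x _; rewrite -[in LHS](funrposBneg f).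
rewrite RintegralB// (ge0 _ (funrpos_ge0 f) ip) (ge0 _ (funrneg_ge0 f) im).
rewrite -RintegralB//; last 2 first.
- exact: integrable_density ip.
- exact: integrable_density im.
apply: eq_Rintegral => x _; rewrite -mulrBl.
by rewrite -[in RHS](funrposBneg f).
Qed.

End density.

(* [lebesgue_measure] and the laws of real random variables live on two copies
   of the Borel sigma-algebra that carry different displays; pushing forward
   along the identity moves a law from one copy to the other. *)
Section real_density.
Context {R : realType}.
Local Notation mu := (@lebesgue_measure R).
Variables (nu : probability R R) (h : R -> R).
Hypothesis inth : mu.-integrable setT (EFin \o h).
Hypothesis h0 : forall x, 0 <= h x.
Hypothesis nuE :
  (forall A, measurable A -> nu A = \int[mu]_(x in A) (h x)%:E)%E.

Let measurable_id' : measurable_fun setT (id : R -> measurableTypeR R).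
Proof. by move=> _ B mB; rewrite setTI. Qed.

Let idR : {mfun R >-> measurableTypeR R} :=
  HB.pack (id : R -> measurableTypeR R)
    (isMeasurableFun.Build _ _ _ _ _ measurable_id').

Let nu' : probability (measurableTypeR R) R := distribution nu idR.

Let nu'E : (forall A, measurable A -> nu' A = \int[mu]_(x in A) (h x)%:E)%E.
Proof. exact: nuE. Qed.

Let integrable_nu' (f : R -> R) : nu.-integrable setT (EFin \o f) ->
  nu'.-integrable setT (EFin \o f).
Proof.
move=> /integrableP[mf foo]; apply/integrableP; split; first exact: mf.
rewrite ge0_integral_distribution//.
by apply: measurableT_comp => //; exact: mf.
Qed.

Lemma integrable_real_density (f : R -> R) : nu.-integrable setT (EFin \o f) ->
  mu.-integrable setT (EFin \o (fun x => f x * h x)).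
Proof.
by move=> /integrable_nu' /(integrable_density inth h0 nu'E).
Qed.

Lemma Rintegral_real_density (f : R -> R) : nu.-integrable setT (EFin \o f) ->
  \int[nu]_x f x = \int[mu]_x (f x * h x).
Proof.
move=> intf; rewrite -(Rintegral_density inth h0 nu'E (integrable_nu' intf)).
congr fine; rewrite integral_distribution//.
by have /integrableP[] := integrable_nu' intf.
Qed.

End real_density.

(** * Regular densities and their scores *)

Section regular_density.
Context {R : realType}.
Local Notation mu := (@lebesgue_measure R).
Local Notation half := (`]0%R, +oo[%classic : set R).
Variable f : R -> R.
Hypothesis fr : regular_density f.

Lemma regular_density_ge0 (x : R) : 0 <= f x.
Proof.
have [x0|x0] := leP x 0; first by rewrite (density_eq0 fr).
by rewrite ltW// (density_pos fr).
Qed.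

Lemma regular_density_is_derive (x : R) : 0 < x -> is_derive x (1 : R) f (derive1 f x).
Proof.
by move=> /(density_C1 fr)[df _]; rewrite derive1E; exact: derivableP.
Qed.

Lemma regular_density_continuous (x : R) : 0 < x -> {for x, continuous f}.
Proof.
move=> /(density_C1 fr)[df _].
exact/differentiable_continuous/derivable1_diffP.
Qed.

Lemma score_continuous (x : R) : 0 < x -> {for x, continuous (score f)}.
Proof.
move=> x0; apply: continuousM; first by case: (density_C1 fr x0).
by apply: continuousV; [rewrite gt_eqF// (density_pos fr)|exact: regular_density_continuous].
Qed.

Lemma regular_density_integrable : mu.-integrable setT (EFin \o f).
Proof.
apply/integrableP; split.
  apply/measurable_EFinP.
  have -> : f = f \_ half.
    apply/funext => x; rewrite patchE; case: ifPn => //.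
    by rewrite notin_setE/= in_itv/= andbT => /negP; rewrite -leNgt => /(density_eq0 fr).
  apply/(measurable_restrictT _ _).1 => //.
  apply: measurable_fun_pos_continuous; exact: regular_density_continuous.
under eq_integral do rewrite gee0_abs ?lee_fin ?regular_density_ge0//.
by rewrite (density_integral1 fr) ltry.
Qed.

End regular_density.

(** The differential equation makes the quotient [f / h] constant, and the constant is 1 because
    both densities have total mass 1. *)
Lemma regular_density_unique (R : realType) (f h : R -> R) :
  regular_density f -> regular_density h ->
  (forall x : R, 0 < x -> is_derive x (1 : R) f (score h x * f x)) -> f = h.
Proof.
move=> fr hr fh; pose r x := f x * (h x)^-1.
have h0 (x : R) : 0 < x -> h x != 0 by move=> x0; rewrite gt_eqF// (density_pos hr).
have r0 (x : R) : 0 < x -> is_derive x (1 : R) r 0.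
  move=> x0; have Dh := regular_density_is_derive hr x0.
  have Df := fh x x0.
  have Dr := is_deriveM Df (is_deriveV (h0 x x0) Dh).
  apply: (is_derive_eq Dr).
  by rewrite /score /GRing.scale/=; field; exact: h0.
have fE (x : R) : f x = r 1 * h x.
  have [x0|x0] := leP x 0.
    by rewrite (density_eq0 fr)// (density_eq0 hr)// mulr0.
  have /eqP := eq_of_derive_cst x0 ltr01 r0.
  by rewrite mul0r subr_eq0 => /eqP ->; rewrite /r divfK// h0.
have : (\int[lebesgue_measure]_x (f x)%:E = (r 1)%:E)%E.
  under eq_integral do rewrite fE EFinM.
  rewrite integralZl//; last exact: regular_density_integrable.
  by rewrite (density_integral1 hr) mule1.
rewrite (density_integral1 fr) => -[r1].
by apply/funext => x; rewrite fE -r1 mul1r.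
Qed.

(** * Compactness and averages *)

Lemma compact_countable_dense (R : realType) (T : normedModType R) (K : set T) :
  compact K -> K !=set0 ->
  exists D : nat -> T, (forall k, K (D k)) /\
    forall x e, K x -> 0 < e -> exists k, ball x e (D k).
Proof.
rewrite compact_cover => cK [x0 Kx0].
have fin n : exists F : {fset T}, {subset F <= K} /\
    K `<=` \bigcup_(x in [set` F]) ball x n.+1%:R^-1.
  have [||F FK KF] := cK T K (fun x => (ball x n.+1%:R^-1)^°).
  - by move=> x _; exact: open_interior.
  - move=> x Kx; exists x => //; apply: nbhsx_ballx.
    by rewrite invr_gt0.
  exists F; split=> // x /KF[y Fy xy]; exists y => //; exact: interior_subset xy.
have [F HF] := choice fin.
(* [D] enumerates the finite nets of radius [n.+1^-1] over all [n]; codes and indices that name no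
   point fall back on [x0], which keeps [D] inside [K]. *)
pose D k := if @choice.unpickle (nat * nat)%type k is Some ni then nth x0 (F ni.1) ni.2 else x0.
exists D; split=> [k|x e Kx e0].
  rewrite /D; case: choice.unpickle => [[n i]|//] /=.
  have [iF|iF] := ltnP i (size (F n)); last by rewrite nth_default.
  by apply/set_mem; apply: (HF n).1; exact: mem_nth.
have [n ne] : exists n, n.+1%:R^-1 <= e.
  exists (Num.bound e^-1); rewrite invf_ple ?posrE//.
  by rewrite (le_trans (ltW (archi_boundP _))) ?ler_nat// invr_ge0 ltW.
have [y /= yF yx] := (HF n).2 x Kx.
exists (choice.pickle (n, index y (F n))); rewrite /D choice.pickleK/= nth_index//.
by apply: ball_sym; exact: le_ball yx.
Qed.

(** The bound [k <= s k] stands in for strict monotonicity: it makes [s] tend to infinity, which is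
    what passing to the subsequence requires. *)
Lemma compact_subsequence (R : realType) (T : normedModType R) (K : set T)
    (y : nat -> T) (Q : nat -> Prop) :
  compact K -> (forall N, exists n, [/\ (N <= n)%N, Q n & K (y n)]) ->
  exists l (s : nat -> nat), [/\ K l, (forall k, (k <= s k)%N),
    (forall k, Q (s k)), (forall k, K (y (s k))) & y (s k) @[k --> \oo] --> l].
Proof.
move=> cK /choice[s Hs].
have [|l [Kl cl]] := cK ((y \o s) @ \oo) _.
  by exists 0%N => // k _ /=; case: (Hs k).
have /choice[j Hj] k : exists j, (k <= j)%N /\ ball l k.+1%:R^-1 (y (s j)).
  have [||_ [[j /= kj <-] lj]] := cl [set y (s j) | j in [set j | (k <= j)%N]]
    (ball l k.+1%:R^-1).
  - by exists k => // j kj; exists j.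
  - by apply: nbhsx_ballx; rewrite invr_gt0.
  by exists j.
exists l, (s \o j); split=> //.
- by move=> k; have [sj _ _] := Hs (j k); exact: leq_trans (Hj k).1 sj.
- by move=> k; case: (Hs (j k)).
- by move=> k; case: (Hs (j k)).
apply/cvg_ballP => e e0; near=> k.
apply: le_ball (Hj k).2; apply: ltW; near: k.
exact: (cvgr_lt _ (@cvg_harmonic R) _ e0).
Unshelve. all: end_near. Qed.

Section averages.
Context {R : realType}.
Variable x : nat -> R.

Definition avg (n : nat) (f : R -> R) : R := n%:R^-1 * \sum_(j < n) f (x j).

Lemma avgD n f g : avg n (fun y => f y + g y) = avg n f + avg n g.
Proof. by rewrite /avg big_split/= mulrDr. Qed.

Lemma avgB n f g : avg n (fun y => f y - g y) = avg n f - avg n g.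
Proof. by rewrite /avg sumrB/= mulrBr. Qed.

Lemma avgZ n c f : avg n (fun y => c * f y) = c * avg n f.
Proof. by rewrite /avg -mulr_sumr mulrCA. Qed.

Lemma ler_norm_avgB n f g v : (forall j, `|f (x j) - g (x j)| <= v (x j)) ->
  `|avg n f - avg n g| <= avg n v.
Proof.
move=> fgv; rewrite -avgB normrM ger0_norm ?invr_ge0// ler_wpM2l ?invr_ge0//.
by rewrite (le_trans (ler_norm_sum _ _ _))// ler_sum.
Qed.

(** The approximant [l] and the error envelope [v] may change with [e], so they can be drawn from
    the countable family whose averages are known to converge. *)
Lemma cvg_avg_approx (f : R -> R) (c : R) :
  (forall e, 0 < e -> exists l v a b,
    [/\ forall j, `|f (x j) - l (x j)| <= v (x j),
        avg n l @[n --> \oo] --> a, avg n v @[n --> \oo] --> b,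
        b <= e & `|a - c| <= e]) ->
  avg n f @[n --> \oo] --> c.
Proof.
move=> H; apply/cvgrPdist_le => e e0.
(* Four errors add up: [avg v] against [b], the size of [b], [avg l] against [a], and [a] against
   [c]. *)
have e4 : 0 < e / 4 by rewrite divr_gt0.
have [l [v [a [b [fl /cvgrPdist_le/(_ _ e4) la /cvgrPdist_le/(_ _ e4) vb be ac]]]]] := H _ e4.
near=> n.
have h1 : `|a - avg n l| <= e / 4 by near: n.
have h2 : `|b - avg n v| <= e / 4 by near: n.
have := ler_norm_avgB n fl.
move: h1 h2 ac; rewrite !ler_norml => /andP[? ?] /andP[? ?] /andP[? ?] /andP[? ?].
by apply/andP; split; lra.
Unshelve. all: end_near. Qed.

Lemma cvg_bounded_seq (u : nat -> R) (l : R) : u n @[n --> \oo] --> l ->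
  exists M, forall n, u n <= M.
Proof.
move=> ul; have /cvg_seq_bounded : cvgn u by apply/cvg_ex; exists l.
move=> [M [_ /(_ (M + 1))]] H; exists (M + 1) => n.
by rewrite (le_trans (ler_norm _))// H// ltrDl.
Qed.

End averages.

(** * Weighted norms *)

Section weighted_norm.
Context {R : realType}.
Local Notation mu := (@lebesgue_measure R).
Local Notation half := (`]0%R, +oo[%classic : set R).
Variables (q : R) (w : R -> R).
Hypothesis q_ge1 : 1 <= q.
Hypothesis w_pos : forall t : R, 0 < t -> 0 < w t.
Hypothesis w_int : mu.-integrable half (EFin \o w).

Let q0 : 0 < q. Proof. exact: lt_le_trans q_ge1. Qed.

Let mw : measurable_fun half w.
Proof. by apply/measurable_EFinP; exact: measurable_int w_int. Qed.

Let measurable_integrand (f : R -> R) : measurable_fun half f ->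
  measurable_fun half (fun t => (`|f t| `^ q * w t)%:E).
Proof.
move=> mf; apply/measurable_EFinP; apply: measurable_funM => //.
apply: (measurableT_comp (measurable_powR q)); exact: measurableT_comp.
Qed.

Let integrand_ge0 (f : R -> R) (t : R) : half t -> (0 <= (`|f t| `^ q * w t)%:E)%E.
Proof.
by rewrite /= in_itv/= andbT => t0; rewrite lee_fin mulr_ge0 ?powR_ge0// ltW ?w_pos.
Qed.

Lemma Lq_norm_le (f : R -> R) (e : R) : 0 < e ->
  (Lq_norm q w f <= e%:E)%E =
  (\int[mu]_(t in half) (`|f t| `^ q * w t)%:E <= (e `^ q)%:E)%E.
Proof.
move=> e0; rewrite /Lq_norm.
have I0 : (0 <= \int[mu]_(t in half) (`|f t| `^ q * w t)%:E)%E.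
  by apply: integral_ge0 => t; exact: integrand_ge0.
move: I0; set I := (\int[mu]_(t in half) _)%E => I0.
have nng (a : \bar R) : (0 <= a)%E -> a \in `[0%E, +oo%E] by rewrite in_itv/= leey andbT.
apply/idP/idP => H.
- have -> : I = ((I `^ q^-1) `^ q)%E by rewrite -poweRrM mulVf ?gt_eqF// poweRe1.
  have := @gt0_ler_poweR R q (ltW q0) (I `^ q^-1)%E e%:E.
  by rewrite poweR_EFin; apply => //; apply: nng; rewrite ?poweR_ge0// lee_fin ltW.
- have -> : e%:E = ((e `^ q)%:E `^ q^-1)%E.
    by rewrite poweR_EFin -powRrM mulfV ?gt_eqF// powRr1// ltW.
  apply: gt0_ler_poweR => //; rewrite ?invr_ge0 ?ltW//; apply: nng => //.
  by rewrite lee_fin powR_ge0.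
Qed.

Lemma Lq_norm_dominated (F : nat -> R -> R) (M : R) :
  (forall n, measurable_fun half (F n)) ->
  (forall n t, 0 < t -> `|F n t| <= M) ->
  (forall t, 0 < t -> F n t @[n --> \oo] --> (0 : R)) ->
  forall e : R, 0 < e -> \forall n \near \oo, (Lq_norm q w (F n) <= e%:E)%E.
Proof.
move=> mF FM F0 e e0.
have pw (t : R) : 0 < t -> half t by rewrite /= in_itv/= andbT.
have : (\int[mu]_(t in half) (`|F n t| `^ q * w t)%:E)%E @[n --> \oo]
    --> (\int[mu]_(t in half) 0)%E.
  apply: (@dominated_cvg _ _ _ mu half _ _ _
    (fun t => (M `^ q)%:E * (w t)%:E)%E) => //.
  - by move=> n; exact: measurable_integrand.
  - move=> t /=; rewrite in_itv/= andbT => t0.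
    apply: cvg_EFin; first exact: nearW.
    rewrite -[X in _ --> X](mul0r (w t)); apply: cvgMl.
    apply/cvgrPdist_le => d d0.
    have dq : 0 < d `^ q^-1 by exact: powR_gt0.
    move/cvgrPdist_le : (F0 t t0) => /(_ _ dq); apply: filterS => n.
    rewrite !sub0r !normrN => Fd; rewrite ger0_norm ?powR_ge0//.
    have -> : d = (d `^ q^-1) `^ q by rewrite -powRrM mulVf ?gt_eqF// powRr1// ltW.
    by rewrite ge0_ler_powR ?nnegrE ?powR_ge0// ltW.
  - by apply: integrableZl.
  - move=> n t /=; rewrite in_itv/= andbT => t0.
    have w0 := ltW (w_pos t0).
    rewrite lee_fin ger0_norm ?mulr_ge0 ?powR_ge0// ler_wpM2r//.
    apply: ge0_ler_powR; rewrite ?nnegrE ?(ltW q0)//; last exact: FM.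
    exact: le_trans (FM n t t0).
rewrite integral0 => /fine_cvgP[fin].
have eq0 : 0 < e `^ q by exact: powR_gt0.
move/cvgrPdist_le => /(_ _ eq0); apply: filterS2 fin => n fn.
rewrite sub0r normrN Lq_norm_le// => In.
by rewrite -(fineK fn) lee_fin (le_trans (ler_norm _)).
Qed.

(** Fatou's lemma is applied to the integrands capped at [h], which is built from [G / 2]. Where [G]
    is nonzero, [|F n|] eventually exceeds [|G / 2|]; where [G] is zero, so is [h]. The capped
    sequence is thus eventually equal to [h], and monotonicity of the power replaces its
    continuity. *)
Lemma Lq_norm_fatou (F : nat -> R -> R) (G : R -> R) :
  (forall n, measurable_fun half (F n)) ->
  (forall t, 0 < t -> F n t @[n --> \oo] --> G t) ->
  (forall e : R, 0 < e -> \forall n \near \oo, (Lq_norm q w (F n) <= e%:E)%E) ->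
  {ae mu, forall t, 0 < t -> G t = 0}.
Proof.
move=> mF FG F0.
have mG : measurable_fun half G.
  apply: (measurable_fun_cvg mF) => t /=.
  by rewrite in_itv/= andbT; exact: FG.
pose h t := (`|G t / 2| `^ q * w t)%:E.
have mh : measurable_fun half h.
  by apply: measurable_integrand; exact: measurable_funM.
pose f n t := mine (`|F n t| `^ q * w t)%:E (h t).
have mf n : measurable_fun half (f n).
  by apply: measurable_mine => //; exact: measurable_integrand.
have f0 n t : half t -> (0 <= f n t)%E.
  move=> ht; rewrite /f le_min; apply/andP; split.
    exact: (@integrand_ge0 (F n)).
  exact: (@integrand_ge0 (fun t => G t / 2)).
have fh t : half t -> f n t @[n --> \oo] --> h t.
  move=> /[dup] ht; rewrite /= in_itv/= andbT => t0.
  apply: cvg_near_cst; have [G0|G0] := eqVneq (G t) 0.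
    apply: nearW => n; rewrite /f min_r// /h G0 mul0r normr0 powR0 ?gt_eqF//.
    by rewrite mul0r; exact: integrand_ge0.
  have : `|F n t| @[n --> \oo] --> `|G t| by apply: cvg_norm; exact: FG.
  have G2 : `|G t / 2| < `|G t|.
    rewrite normrM [X in _ * X]ger0_norm// ltr_pdivrMr// ltr_pMr ?normr_gt0//.
    by rewrite ltr1n.
  move=> /cvgr_gt/(_ _ G2); apply: filterS => n Gn.
  rewrite /f min_r// /h lee_fin ler_wpM2r ?(ltW (w_pos t0))//.
  by rewrite ge0_ler_powR ?nnegrE// ltW.
have int_le n : (\int[mu]_(t in half) f n t <=
    \int[mu]_(t in half) (`|F n t| `^ q * w t)%:E)%E.
  apply: ge0_le_integral => //; first exact: f0.
  - exact: mf.
  - exact: measurable_integrand.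
  - by move=> t ht; rewrite /f ge_min lexx.
have intf0 : (\int[mu]_(t in half) f n t)%E @[n --> \oo] --> 0%E.
  apply/fine_cvgP; split.
    have := F0 1 ltr01; apply: filterS => n; rewrite Lq_norm_le// => H.
    rewrite ge0_fin_numE; last by apply: integral_ge0 => t; exact: f0.
    apply: le_lt_trans (ltry (1 `^ q)); exact: le_trans (int_le n) H.
  apply/cvgrPdist_le => e e0.
  have eq0 : 0 < e `^ q^-1 by exact: powR_gt0.
  have := F0 _ eq0; apply: filterS => n.
  rewrite Lq_norm_le// -powRrM mulVf ?gt_eqF// powRr1 ?(ltW e0)// => H.
  rewrite sub0r normrN ger0_norm; last first.
    by apply: fine_ge0; apply: integral_ge0 => t; exact: f0.
  rewrite -lee_fin fineK; last first.
    rewrite ge0_fin_numE; last by apply: integral_ge0 => t; exact: f0.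
    apply: le_lt_trans (ltry e); exact: le_trans (int_le n) H.
  exact: le_trans (int_le n) H.
have inth : (\int[mu]_(t in half) h t = 0)%E.
  apply/eqP; rewrite eq_le integral_ge0 ?andbT; last first.
    by move=> t; exact: (@integrand_ge0 (fun t => G t / 2)).
  have := @fatou _ _ _ mu half (measurable_itv _) f mf f0.
  rewrite (is_cvg_limn_einfE (cvgP _ intf0)) (cvg_lim _ intf0)//.
  apply: le_trans; rewrite le_eqVlt; apply/orP; left; apply/eqP.
  apply: eq_integral => t /[!inE] ht.
  by rewrite (is_cvg_limn_einfE (cvgP _ (fh t ht))) (cvg_lim _ (fh t ht)).
have /(ae_eq_integral_abs mu (measurable_itv _) mh).1 :
    (\int[mu]_(t in half) `|h t| = 0)%E.
  rewrite -inth; apply: eq_integral => t /[!inE] ht.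
  by rewrite gee0_abs//; exact: (@integrand_ge0 (fun t => G t / 2)).
apply: filterS => t H t0.
have /H[] : half t by rewrite /= in_itv/= t0.
move/eqP; rewrite mulf_eq0 (gt_eqF (w_pos t0)) orbF powR_eq0.
by rewrite normr_eq0 mulf_eq0 invr_eq0 pnatr_eq0 orbF => /andP[/eqP].
Qed.

End weighted_norm.

(** * Means over the positive half-line *)

Section mean_on_half_line.
Context {R : realType}.
Local Notation half := (`]0%R, +oo[%classic : set R).
Variable nu : probability R R.

(** Scores and envelopes are controlled on the positive half-line only, so integrands are set to 0
    elsewhere; for positive observations this changes nothing. *)
Definition mean (u : R -> R) : R := \int[nu]_y (u \_ half) y.

Definition integrable_mean (u : R -> R) := nu.-integrable setT (EFin \o u \_ half).

Let halfE (y : R) : (y \in half) = (0 < y).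
Proof. by apply/idP/idP; rewrite inE/= in_itv/= andbT. Qed.

Lemma mean_ge0 (u : R -> R) : (forall y, 0 < y -> 0 <= u y) -> 0 <= mean u.
Proof.
move=> u0; apply: Rintegral_ge0 => y _; rewrite patchE halfE.
by case: ifPn => // /u0.
Qed.

Lemma le_integrable_mean (u v : R -> R) : measurable_fun half u ->
  (forall y, 0 < y -> `|u y| <= `|v y|) -> integrable_mean v -> integrable_mean u.
Proof.
move=> mu uv; apply: le_integrable => //.
  by apply/measurable_EFinP; apply/(measurable_restrictT _ _).1.
move=> y _; rewrite lee_fin !patchE halfE; by case: ifPn => // /uv.
Qed.

Lemma integrable_meanD (a b : R) (u v : R -> R) : integrable_mean u -> integrable_mean v ->
  integrable_mean (fun y => a * u y + b * v y).
Proof.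
move=> iu iv.
have := integrableD measurableT (integrableZl measurableT a iu) (integrableZl measurableT b iv).
apply: eq_integrable => // y _ /=; rewrite !patchE.
by case: ifPn; rewrite // !mule0 addr0.
Qed.

Lemma meanD (a b : R) (u v : R -> R) : integrable_mean u -> integrable_mean v ->
  mean (fun y => a * u y + b * v y) = a * mean u + b * mean v.
Proof.
move=> iu iv; rewrite /mean -!RintegralZl// -RintegralD//.
- apply: eq_Rintegral => y _; rewrite !patchE.
  by case: ifPn; rewrite // !mulr0 addr0.
- exact: (integrableZl measurableT a iu).
- exact: (integrableZl measurableT b iv).
Qed.

Lemma mean_approx (u l v : R -> R) : integrable_mean u -> integrable_mean l ->
  integrable_mean v -> (forall y, 0 < y -> `|u y - l y| <= v y) ->
  `|mean l - mean u| <= mean v.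
Proof.
move=> iu il iv ulv; rewrite distrC /mean -RintegralB//.
have iB : nu.-integrable setT (EFin \o (fun y => (u \_ half) y - (l \_ half) y)).
  by have := integrableB measurableT iu il.
apply: (le_trans (le_normr_Rintegral _ iB)) => //.
apply: le_Rintegral => //; first exact: integrable_norm iB.
move=> y _; rewrite !patchE halfE; case: ifPn => [/ulv //|_].
by rewrite subrr normr0.
Qed.

End mean_on_half_line.

(** * From countably many averages to all parameters and thresholds *)

Section uniform_averages.
Context {R : realType}.
Local Notation half := (`]0%R, +oo[%classic : set R).
Variables (nu : probability R R) (I : Type) (s : I -> R -> R) (K : set I).
Variables (H : R -> R) (c : I -> I -> R) (D : nat -> I) (x : nat -> R).
Hypothesis x_pos : forall j, 0 < x j.
Hypothesis s_meas : forall i, K i -> measurable_fun half (s i).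
Hypothesis s_int : forall i, K i -> integrable_mean nu (fun y => s i y * y).
Hypothesis H_ge0 : forall y, 0 < y -> 0 <= H y.
Hypothesis H_int : integrable_mean nu (fun y => H y * y).
Hypothesis s_lip : forall y i j, 0 < y -> K i -> K j ->
  `|s j y - s i y| <= H y * c i j.
Hypothesis D_in : forall k, K (D k).
Hypothesis D_dense : forall i e, K i -> 0 < e -> exists k, c i (D k) <= e.

Lemma integrable_mean_min (i : I) (t : R) : K i -> 0 < t ->
  integrable_mean nu (fun y => s i y * Num.min y t).
Proof.
move=> Ki t0; apply: le_integrable_mean (s_int Ki).
  by apply: measurable_funM; [exact: s_meas|exact: measurable_minr].
move=> y y0; rewrite !normrM ler_wpM2l// (gtr0_norm y0) ger0_norm ?ge_min ?lexx//.
by rewrite le_min !ltW.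
Qed.

Lemma integrable_mean_norm (i : I) : K i ->
  integrable_mean nu (fun y => `|s i y * y|).
Proof.
move=> Ki; apply: le_integrable_mean (s_int Ki) => [|y _]; last by rewrite normr_id.
by apply: measurableT_comp => //; apply: measurable_funM => //; exact: s_meas.
Qed.

(** The difference vanishes for [y <= t], and beyond [t] the constant [r - t] is at most
    [(r - t) / t * y]. A bound proportional to [y] is wanted because the score times [y] is
    integrable. *)
Lemma min_lipschitz (y t r : R) : 0 < y -> 0 < t -> t <= r ->
  `|Num.min y t - Num.min y r| <= (r - t) / t * y.
Proof.
move=> y0 t0 tr; have [yt|ty] := leP y t.
  rewrite min_l ?(le_trans yt)// subrr normr0 mulr_ge0 ?(ltW y0)//.
  by rewrite divr_ge0 ?subr_ge0// ltW.
have h : t <= Num.min y r by rewrite le_min tr ltW.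
rewrite distrC ger0_norm ?subr_ge0//.
apply: (@le_trans _ _ (r - t)); first by rewrite lerB// ge_min lexx orbT.
by rewrite -mulrA ler_peMr ?subr_ge0// mulrC ler_pdivlMr// mul1r ltW.
Qed.

Hypothesis avg_min : forall k (r : rat), 0 < ratr r :> R ->
  avg x n (fun y => s (D k) y * Num.min y (ratr r)) @[n --> \oo] -->
  mean nu (fun y => s (D k) y * Num.min y (ratr r)).
Hypothesis avg_norm : forall k,
  avg x n (fun y => `|s (D k) y * y|) @[n --> \oo] -->
  mean nu (fun y => `|s (D k) y * y|).
Hypothesis avg_H :
  avg x n (fun y => H y * y) @[n --> \oo] --> mean nu (fun y => H y * y).

(** Here [c i j] is the Hölder factor of the distance. Replacing [i] by some [D k] costs at most
    [e1 * (H y * y)], and then replacing [t] by a rational [r] costs at most [e2 * |s (D k) y * y|];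
    both envelopes have convergent averages. *)
Lemma cvg_avg_min (i : I) (t : R) : K i -> 0 < t ->
  avg x n (fun y => s i y * Num.min y t) @[n --> \oo] -->
  mean nu (fun y => s i y * Num.min y t).
Proof.
move=> Ki t0; apply: cvg_avg_approx => e e0.
pose CH := mean nu (fun y => H y * y).
have CH0 : 0 <= CH by apply: mean_ge0 => y y0; rewrite mulr_ge0 ?H_ge0// ltW.
pose e1 := e / (2 * (CH + 1)).
have e10 : 0 < e1 by rewrite divr_gt0// mulr_gt0// ltr_pwDr.
have [k ck] := D_dense Ki e10.
pose B := mean nu (fun y => `|s (D k) y * y|).
have B0 : 0 <= B by apply: mean_ge0.
(* [e1] and [e2] make each error at most [e / 2] in mean; [e2] depends on [k] through [B], so the
   parameter is chosen before the threshold. *)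
pose e2 := e / (2 * (B + 1)).
have e20 : 0 < e2 by rewrite divr_gt0// mulr_gt0// ltr_pwDr.
have [r] : exists r : rat, ratr r \in `]t, (t + t * e2)[.
  by apply: rat_in_itvoo; rewrite ltrDl mulr_gt0.
rewrite in_itv/= => /andP[tr rt].
have r0 : 0 < ratr r :> R by exact: lt_trans tr.
pose l y := s (D k) y * Num.min y (ratr r).
pose v y := e1 * (H y * y) + e2 * `|s (D k) y * y|.
have lv y : 0 < y -> `|s i y * Num.min y t - l y| <= v y.
  move=> y0; have -> : s i y * Num.min y t - l y =
      (s i y - s (D k) y) * Num.min y t +
      s (D k) y * (Num.min y t - Num.min y (ratr r)) by rewrite /l; ring.
  rewrite (le_trans (ler_normD _ _))// lerD// normrM.
    rewrite mulrA; apply: ler_pM => //.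
      rewrite distrC (le_trans (s_lip y0 Ki (D_in k)))// mulrC.
      by rewrite ler_wpM2r// H_ge0.
    by rewrite ger0_norm ?ge_min ?lexx// le_min !ltW.
  rewrite normrM mulrCA ler_wpM2l//.
  rewrite (le_trans (min_lipschitz y0 t0 (ltW tr)))// (gtr0_norm y0).
  by rewrite ler_wpM2r ?(ltW y0)// ler_pdivrMr// lerBlDl mulrC ltW.
have iv : integrable_mean nu v.
  exact: integrable_meanD H_int (integrable_mean_norm (D_in k)).
have vb : mean nu v <= e.
  rewrite meanD//; last exact: integrable_mean_norm.
  have -> : e = e / 2 + e / 2 by rewrite -splitr.
  have half_le C : 0 <= C -> e / (2 * (C + 1)) * C <= e / 2.
    move=> C0; rewrite invfM mulrA -mulrA ler_piMr ?divr_ge0 ?(ltW e0)//.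
    by rewrite mulrC ler_pdivrMr ?ltr_pwDr// mul1r lerDl.
  by rewrite lerD// half_le.
exists l, v, (mean nu l), (mean nu v); split => //.
- by move=> j; exact: lv.
- exact: avg_min.
- have : e1 * avg x n (fun y => H y * y) + e2 * avg x n (fun y => `|s (D k) y * y|)
      @[n --> \oo] --> e1 * CH + e2 * B.
    by apply: cvgD; apply: cvgM => //; exact: cvg_cst.
  rewrite -meanD//; last exact: integrable_mean_norm.
  by under eq_fun do rewrite -!avgZ -avgD.
- apply: (le_trans _ vb); apply: mean_approx => //.
  + exact: integrable_mean_min.
  + exact: integrable_mean_min.
Qed.

End uniform_averages.

(** Indicators are monotone in the threshold, so [t] is bracketed by rationals [r1 < t < r2]; the
    error is the mass of the bracket, small by continuity of [F]. *)
Lemma cvg_avg_indic (R : realType) (F : R -> R) (x : nat -> R) (t : R) : 0 < t ->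
  {for t, continuous F} ->
  (forall r : rat, avg x n \1_(`]-oo, ratr r]) @[n --> \oo] --> F (ratr r)) ->
  avg x n \1_(`]-oo, t]) @[n --> \oo] --> F t.
Proof.
move=> t0 Fc xF; apply: cvg_avg_approx => e e0.
have e20 : 0 < e / 2 by rewrite divr_gt0.
move/cvgrPdist_le : Fc => /(_ _ e20)/nbhs_ballP[d /= d0 td].
have [r1] : exists r : rat, ratr r \in `](t - d), t[.
  by apply: rat_in_itvoo; rewrite ltrBlDr ltrDl.
rewrite in_itv/= => /andP[dr1 r1t].
have [r2] : exists r : rat, ratr r \in `]t, (t + d)[.
  by apply: rat_in_itvoo; rewrite ltrDl.
rewrite in_itv/= => /andP[tr2 r2d].
have Fr1 : `|F t - F (ratr r1)| <= e / 2.
  by apply: td; rewrite /ball/= ger0_norm ?subr_ge0 ?ltW//; lra.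
have Fr2 : `|F t - F (ratr r2)| <= e / 2.
  by apply: td; rewrite /ball/= ler0_norm ?subr_le0 ?ltW//; lra.
pose v (y : R) : R := \1_(`]-oo, ratr r2]) y - \1_(`]-oo, ratr r1]) y.
exists \1_(`]-oo, ratr r1]), v, (F (ratr r1)), (F (ratr r2) - F (ratr r1)).
split.
- move=> j; rewrite /v !indicE.
  have E (u : R) : (x j \in `]-oo, u]%classic) = (x j <= u).
    by apply/idP/idP; rewrite inE/= in_itv.
  rewrite !E; case: (leP (x j) (ratr r1)) => h1.
    have h2 := le_trans h1 (ltW r1t).
    by rewrite h2 (le_trans h2 (ltW tr2)) !subrr normr0.
  rewrite !subr0; case: (leP (x j) t) => h2; last by rewrite normr0 ler0n.
  by rewrite (le_trans h2 (ltW tr2)) normr1.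
- exact: xF.
- rewrite /v; under eq_fun do rewrite avgB.
  by apply: cvgB; exact: xF.
- by move: Fr1 Fr2; rewrite !ler_norml => /andP[? ?] /andP[? ?]; lra.
- by rewrite distrC (le_trans Fr1)//; lra.
Qed.

(** * Consistency *)

(** This links the Euclidean distance of the statement with the topology of row vectors, which comes
    from the sup norm. *)
Lemma continuous_euclidean_dist (R : realType) (m : nat) (v : 'rV[R]_m) :
  continuous (fun u : 'rV[R]_m => euclidean_norm (u - v)).
Proof.
move=> u; apply: (continuous_comp (f := fun u : 'rV[R]_m =>
  \sum_(i < m) (u - v) ord0 i ^+ 2) (g := Num.sqrt)); last exact: sqrt_continuous.
apply: (@continuous_big _ _ _ _ _ (@add_continuous R^o)) => i _ {}u.
have -> : (fun u : 'rV[R]_m => (u - v) ord0 i ^+ 2) =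
    (fun u => (u ord0 i - v ord0 i) * (u ord0 i - v ord0 i)).
  by apply/funext => z; rewrite !mxE expr2.
have cB : {for u, continuous (fun z : 'rV[R]_m => z ord0 i - v ord0 i : R)}.
  apply: continuousB; last exact: cst_continuous.
  exact: coord_continuous.
exact: (continuousM cB cB).
Qed.

Lemma euclidean_dist0 (R : realType) (m : nat) (v : 'rV[R]_m) :
  euclidean_norm (v - v) = 0.
Proof.
by rewrite /euclidean_norm big1 ?sqrtr0// => i _; rewrite subrr mxE expr0n.
Qed.

Lemma euclidean_dist_powR_small (R : realType) (m : nat) (v : 'rV[R]_m) (a e : R) :
  0 < a -> 0 < e ->
  \forall u \near v, euclidean_norm (u - v) `^ a <= e.
Proof.
move=> a0 e0; have ea0 : 0 < e `^ a^-1 by exact: powR_gt0.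
have := @continuous_euclidean_dist R m v v; rewrite /continuous_at euclidean_dist0.
move=> /cvgrPdist_le/(_ _ ea0); apply: filterS => u.
rewrite sub0r normrN ger0_norm ?sqrtr_ge0// => uv.
have -> : e = (e `^ a^-1) `^ a by rewrite -powRrM mulVf ?gt_eqF// powRr1// ltW.
by rewrite ge0_ler_powR ?nnegrE ?powR_ge0 ?sqrtr_ge0// ltW.
Qed.

Section consistency.
Context {R : realType} {m : nat}.
Local Notation mu := (@lebesgue_measure R).
Local Notation half := (`]0%R, +oo[%classic : set R).
Variables (Theta : set 'rV[R]_m) (p : 'rV[R]_m -> R -> R) (theta0 : 'rV[R]_m).
Hypothesis p_reg : forall theta, Theta theta -> regular_density (p theta).
Hypothesis p_ident : forall theta theta', Theta theta -> Theta theta' ->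
  theta <> theta' -> p theta <> p theta'.
Hypothesis theta0_in : Theta theta0.
Variable nu : probability R R.
Hypothesis nuE : forall A, measurable A -> (nu A = \int[mu]_(y in A) (p theta0 y)%:E)%E.
Hypothesis score_int : forall theta, Theta theta ->
  integrable_mean nu (fun y => score (p theta) y * y).

Local Notation p0 := (p theta0).

Let p0_reg : regular_density p0. Proof. exact: p_reg. Qed.

Definition limit_eta (theta : 'rV[R]_m) (t : R) : R :=
  - mean nu (fun y => score (p theta) y * Num.min y t) - distribution_function p0 t.

Lemma mean_density (u : R -> R) : integrable_mean nu u ->
  mean nu u = \int[mu]_(y in half) (u y * p0 y).
Proof.
move=> iu; rewrite /mean (Rintegral_real_density (regular_density_integrable p0_reg)
  (regular_density_ge0 p0_reg) nuE iu) [RHS]Rintegral_mkcond.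
by apply: eq_Rintegral => y _; rewrite !patchE; case: ifPn; rewrite ?mul0r.
Qed.

Lemma integrable_density_half (u : R -> R) : integrable_mean nu u ->
  mu.-integrable half (EFin \o (fun y => u y * p0 y)).
Proof.
move=> iu; apply/(integrable_mkcond _ _).2 => //.
have := integrable_real_density (regular_density_integrable p0_reg)
  (regular_density_ge0 p0_reg) nuE iu.
apply: eq_integrable => // y _ /=; rewrite !patchE.
by case: ifPn; rewrite ?mul0r.
Qed.

Lemma measurable_score (theta : 'rV[R]_m) : Theta theta ->
  measurable_fun half (score (p theta)).
Proof.
by move=> /p_reg pr; apply: measurable_fun_pos_continuous; exact: score_continuous.
Qed.

Let g (theta : 'rV[R]_m) (y : R) := score (p theta) y * p0 y.

Let g_cont (theta : 'rV[R]_m) : Theta theta ->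
  forall y : R, 0 < y -> {for y, continuous (g theta)}.
Proof.
move=> /p_reg pr y y0; apply: continuousM; first exact: score_continuous.
exact: (regular_density_continuous p0_reg).
Qed.

Let g_int (theta : 'rV[R]_m) : Theta theta ->
  mu.-integrable half (fun y => (y * g theta y)%:E).
Proof.
move=> /score_int/integrable_density_half; apply: eq_integrable => // y _ /=.
by congr EFin; rewrite /g; ring.
Qed.

Lemma limit_etaE (theta : 'rV[R]_m) (t : R) : Theta theta -> 0 < t ->
  limit_eta theta t = - stein_fun (g theta) p0 t.
Proof.
move=> Tt t0; rewrite /limit_eta /stein_fun mean_density; last first.
  apply: (@integrable_mean_min _ nu _ (fun th => score (p th)) Theta) => //.
  exact: measurable_score.
rewrite opprD; congr (- _ - _); apply: eq_Rintegral => y _.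
by rewrite /g mulrAC.
Qed.

Lemma limit_eta0 (t : R) : 0 < t -> limit_eta theta0 t = 0.
Proof.
move=> t0; rewrite limit_etaE//.
suff -> : stein_fun (g theta0) p0 t = 0 by exact: oppr0.
apply: (stein_identity (g_cont theta0_in) (g_int theta0_in)) => //.
- exact: (regular_density_continuous p0_reg).
- exact: regular_density_integrable.
- exact: (density_eq0 p0_reg).
- move=> y y0; have := regular_density_is_derive p0_reg y0.
  by rewrite /g /score divfK// gt_eqF// (density_pos p0_reg).
Qed.

Lemma limit_eta_eq0 (theta : 'rV[R]_m) : Theta theta ->
  {ae mu, forall t, 0 < t -> limit_eta theta t = 0} -> theta = theta0.
Proof.
move=> Tt H; apply: contrapT => tt0; apply: (p_ident Tt theta0_in tt0).
apply/esym/(regular_density_unique p0_reg (p_reg Tt)).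
apply: (stein_characterization (g_cont Tt) (g_int Tt)) => //.
- exact: (regular_density_continuous p0_reg).
- exact: regular_density_integrable.
- move: H; apply: filterS; first exact: (ae_filter_ringOfSetsType mu).
  move=> t Ht t0; apply/eqP.
  by rewrite -oppr_eq0 -limit_etaE// Ht.
Qed.

(** * Consistency along one fixed realization of the sample *)

Section deterministic_sample.
Variables (q : R) (w : R -> R) (x : nat -> R) (K : set 'rV[R]_m) (H : R -> R) (a : R).
Hypothesis q_ge1 : 1 <= q.
Hypothesis w_pos : forall t : R, 0 < t -> 0 < w t.
Hypothesis w_int : mu.-integrable half (EFin \o w).
Hypothesis x_pos : forall j, 0 < x j.
Hypotheses (K_compact : compact K) (K_sub : K `<=` Theta) (K0 : K theta0).
Hypothesis a0 : 0 < a.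
Hypothesis score_lip : forall (y : R) (theta1 theta2 : 'rV[R]_m),
  0 < y -> K theta1 -> K theta2 ->
  `|score (p theta2) y - score (p theta1) y| <=
    H y * euclidean_norm (theta2 - theta1) `^ a.
Hypothesis avg_min : forall theta t, K theta -> 0 < t ->
  avg x n (fun y => score (p theta) y * Num.min y t) @[n --> \oo] -->
  mean nu (fun y => score (p theta) y * Num.min y t).
Hypothesis avg_cdf : forall t, 0 < t ->
  avg x n \1_(`]-oo, t]) @[n --> \oo] --> distribution_function p0 t.
Hypothesis avg_norm0 :
  avg x n (fun y => `|score p0 y * y|) @[n --> \oo] -->
  mean nu (fun y => `|score p0 y * y|).
Hypothesis avg_H :
  avg x n (fun y => H y * y) @[n --> \oo] --> mean nu (fun y => H y * y).

Definition empirical_eta (theta : 'rV[R]_m) (n : nat) (t : R) : R :=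
  - avg x n (fun y => score (p theta) y * Num.min y t) - avg x n \1_(`]-oo, t]).

Lemma measurable_empirical_eta (theta : 'rV[R]_m) (n : nat) :
  measurable_fun half (empirical_eta theta n).
Proof.
apply: measurable_funTS; apply: measurable_funB.
  apply: measurableT_comp => //; apply: measurable_funM => //.
  apply: measurable_sum => j; apply: measurable_funM => //.
  exact: measurable_minr.
apply: measurable_funM => //; apply: measurable_sum => j.
rewrite (_ : (fun t => _) = \1_(`[x j, +oo[)); first exact: measurable_indic.
apply/funext => t; rewrite !indicE; congr (_ %:R); congr nat_of_bool.
by apply/idP/idP; rewrite !inE/= !in_itv/= ?andbT.
Qed.

Lemma cvg_empirical_eta (theta : 'rV[R]_m) (t : R) : K theta -> 0 < t ->
  empirical_eta theta n t @[n --> \oo] --> limit_eta theta t.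
Proof.
by move=> Kt t0; apply: cvgB; [apply: cvgN; exact: avg_min|exact: avg_cdf].
Qed.

(** The minimum is at most the observation, so the score part is dominated by averages that converge
    and hence are bounded; the empirical distribution function adds at most 1. *)
Lemma empirical_eta_bounded : exists M, forall n (t : R), 0 < t ->
  `|empirical_eta theta0 n t| <= M.
Proof.
have [M HM] := cvg_bounded_seq avg_norm0; exists (M + 1) => n t t0.
rewrite /empirical_eta -opprD normrN (le_trans (ler_normD _ _))// lerD//.
  apply: le_trans (HM n).
  rewrite -[X in `|X|]subr0 -(mul0r (avg x n (cst 0))) -avgZ.
  apply: ler_norm_avgB => j; rewrite mul0r subr0 !normrM ler_wpM2l//.
  by rewrite (gtr0_norm (x_pos j)) ger0_norm ?ge_min ?lexx// le_min !ltW.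
rewrite ger0_norm; last by rewrite mulr_ge0 ?invr_ge0// sumr_ge0.
have [->|n0] := posnP n; first by rewrite /avg big_ord0 mulr0.
rewrite /avg ler_pdivrMl ?ltr0n// mulr1 -[n in leRHS]card_ord -sumr_const.
by apply: ler_sum => j _; rewrite indicE; case: (_ \in _).
Qed.

(** At equal sample size and threshold the indicator parts cancel, and the score parts differ by at
    most the Hölder factor, which tends to 0, times the bounded averages of [H y * y]. *)
Lemma cvg_empirical_eta_subseq (y : nat -> 'rV[R]_m) (s : nat -> nat)
    (l : 'rV[R]_m) (t : R) : K l -> (forall k, K (y k)) -> (forall k, (k <= s k)%N) ->
  y k @[k --> \oo] --> l -> 0 < t ->
  empirical_eta (y k) (s k) t @[k --> \oo] --> limit_eta l t.
Proof.
move=> Kl Ky sk yl t0.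
have sy : s k @[k --> \oo] --> \oo.
  by move=> A [N _ NA]; exists N => // k /= Nk; apply: NA => /=; exact: leq_trans (sk k).
have cl : empirical_eta l (s k) t @[k --> \oo] --> limit_eta l t.
  exact: cvg_comp sy (cvg_empirical_eta Kl t0).
have [M HM] := cvg_bounded_seq avg_H.
suff : empirical_eta (y k) (s k) t - empirical_eta l (s k) t @[k --> \oo] --> (0 : R).
  move=> c0; rewrite -[X in _ --> X]add0r; refine (cvg_trans _ (cvgD c0 cl)).
  by apply: near_eq_cvg; apply: nearW => k; exact: subrK.
apply/cvgrPdist_le => e e0.
have M1 : 0 < `|M| + 1 by rewrite ltr_pwDr.
have eM : 0 < e / (`|M| + 1) by rewrite divr_gt0.
have small := yl _ (euclidean_dist_powR_small l a0 eM).
near=> k; rewrite sub0r normrN /empirical_eta.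
have : euclidean_norm (y k - l) `^ a <= e / (`|M| + 1) by near: k; exact: small.
set c := euclidean_norm (y k - l) `^ a => cs.
have c0 : 0 <= c by exact: powR_ge0.
rewrite [X in `|X|](_ : _ =
    avg x (s k) (fun y => score (p l) y * Num.min y t) -
    avg x (s k) (fun z => score (p (y k)) z * Num.min z t)); last by ring.
have := @ler_norm_avgB R x (s k) (fun y => score (p l) y * Num.min y t)
  (fun z => score (p (y k)) z * Num.min z t) (fun z => c * (H z * z)).
rewrite avgZ => /(_ _)/le_trans; apply.
  move=> j; rewrite -mulrBl normrM distrC mulrA; apply: ler_pM => //.
    by rewrite mulrC; exact: score_lip.
  by rewrite ger0_norm ?ge_min ?lexx// le_min !ltW.
apply: (@le_trans _ _ (c * (`|M| + 1))); last by rewrite -ler_pdivlMr.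
by rewrite ler_wpM2l// (le_trans (HM _))// (le_trans (ler_norm M))// lerDl.
Unshelve. all: end_near. Qed.

(** The conclusion concerns only the sample sizes at which [y n] lies in [K], so that it can be used
    when the estimator leaves [K] with small probability. *)
Lemma argmin_consistent (y : nat -> 'rV[R]_m) (e : nat -> R) :
  (forall n, (0 < n)%N ->
    Lq_norm q w (empirical_eta (y n) n) <=
    Lq_norm q w (empirical_eta theta0 n) + (e n)%:E)%E ->
  e n @[n --> \oo] --> (0 : R) ->
  forall U, nbhs theta0 U -> \forall n \near \oo, K (y n) -> U (y n).
Proof.
move=> ymin e0 U U0; apply: contrapT => nU.
have bad N : exists n, [/\ (N <= n)%N, (0 < n)%N /\ ~ U (y n) & K (y n)].
  apply: contrapT => nb; apply: nU; exists N.+1 => // n /= Nn Kn.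
  apply: contrapT => nUn; apply: nb; exists n; split => //; first exact: ltnW.
  by split => //; exact: leq_trans Nn.
have [l [s [Kl sk Qs Ks sl]]] :=
  @compact_subsequence R 'rV[R]_m K y _ K_compact bad.
have lt0 : l <> theta0.
  move=> l0; rewrite l0 in sl; have [N _ HN] := sl _ U0.
  by have [_] := Qs N; apply; apply: (HN N) => /=.
apply: lt0; apply: limit_eta_eq0; first exact: K_sub.
apply: (@Lq_norm_fatou _ q w q_ge1 w_pos w_int
  (fun k => empirical_eta (y (s k)) (s k))).
- by move=> k; exact: measurable_empirical_eta.
- by move=> t t0; apply: (@cvg_empirical_eta_subseq (y \o s)).
(* Half of [d] bounds the norm at [theta0], the other half the slack [e n] in the minimization. *)
- move=> d d0; have d2 : 0 < d / 2 by rewrite divr_gt0.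
  have [M HM] := empirical_eta_bounded.
  have F0 (t : R) : 0 < t -> empirical_eta theta0 n t @[n --> \oo] --> (0 : R).
    by move=> t0; rewrite -(limit_eta0 t0); exact: cvg_empirical_eta.
  have := Lq_norm_dominated q_ge1 w_pos w_int
    (measurable_empirical_eta theta0) HM F0 d2.
  have /cvgrPdist_le/(_ _ d2) := e0.
  move=> [N1 _ HN1] [N2 _ HN2]; exists (maxn N1 N2) => // k /=.
  rewrite geq_max => /andP[N1k N2k].
  have [s0 _] := Qs k.
  apply: (le_trans (ymin _ s0)); rewrite [d]splitr EFinD leeD//.
    by apply: HN2 => /=; exact: leq_trans (sk k).
  have := HN1 (s k) (leq_trans N1k (sk k)).
  by rewrite /= sub0r normrN lee_fin; apply: le_trans; exact: ler_norm.
Qed.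

End deterministic_sample.
End consistency.

(** * Transfer to the random sample *)

Lemma ae_forall_countable (d : measure_display) (T : measurableType d) (R : realType)
    (mu : {measure set T -> \bar R}) (I : countType) (Q : I -> T -> Prop) :
  (forall i, {ae mu, forall t, Q i t}) -> {ae mu, forall t, forall i, Q i t}.
Proof.
move=> HQ.
have /ae_foralln : forall n, {ae mu, forall t,
    if @choice.unpickle I n is Some i then Q i t else True}.
  by move=> n; case: choice.unpickle => [i|]; [exact: HQ|exact: aeW].
by apply: filterS => t Ht i; have := Ht (choice.pickle i); rewrite choice.pickleK.
Qed.

Section positive_sample.
Context {R : realType} {d : measure_display} {Omega : measurableType d}.
Local Notation half := (`]0%R, +oo[%classic : set R).
Variables (P : probability Omega R) (X : {RV P >-> R}) (Xs : nat -> {RV P >-> R}).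
Hypothesis X_pos : forall w, 0 < X w.
Hypothesis Xs_pos : forall j w, 0 < Xs j w.
Hypothesis Xs_indep : mutually_independent Xs.
Hypothesis Xs_law :
  forall j A, measurable A -> distribution P (Xs j) A = distribution P X A.

Lemma integrable_mean_distribution (u : R -> R) : measurable_fun half u ->
  ('E_P[fun w => `|u (X w)|%R] < +oo)%E -> integrable_mean (distribution P X) u.
Proof.
move=> mu; rewrite unlock => uoo.
have mr : measurable_fun setT (u \_ half) by apply/(measurable_restrictT _ _).1.
apply/integrableP; split; first exact/measurable_EFinP.
rewrite ge0_integral_distribution//; last first.
  by apply: measurableT_comp => //; exact/measurable_EFinP.
apply: le_lt_trans uoo; rewrite le_eqVlt; apply/orP; left; apply/eqP.
apply: eq_integral => w _ /=; rewrite patchE mem_set//=.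
by rewrite in_itv/= X_pos.
Qed.

Lemma strong_law_mean (u : R -> R) : integrable_mean (distribution P X) u ->
  {ae P, forall w, avg (fun j => Xs j w) n u @[n --> \oo] -->
    mean (distribution P X) u}.
Proof.
move=> iu; have := strong_law Xs_indep Xs_law iu.
apply: filterS => w; rewrite /avg.
suff E n : \sum_(j < n) (u \_ half) (Xs j w) = \sum_(j < n) u (Xs j w).
  by under eq_fun do rewrite E.
apply: eq_bigr => j _; rewrite patchE mem_set//=.
by rewrite in_itv/= Xs_pos.
Qed.

Lemma strong_law_cdf (f : R -> R) (t : R) : has_density X f ->
  {ae P, forall w, avg (fun j => Xs j w) n \1_(`]-oo, t]) @[n --> \oo] -->
    distribution_function f t}.
Proof.
move=> Xf; pose nu := distribution P X.
have it : nu.-integrable setT (EFin \o \1_(`]-oo, t])).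
  by apply: integrable_indic => //; rewrite (le_lt_trans (probability_le1 _ _)) ?ltry.
have := strong_law Xs_indep Xs_law it.
suff -> : \int[nu]_x \1_(`]-oo, t]) x = distribution_function f t by [].
rewrite /distribution_function /Rintegral -Xf// integral_indic// setIT.
by [].
Qed.

End positive_sample.

Theorem theorem4p2 (R : realType) (m : nat)
  (Theta : set 'rV[R]_m) (p : 'rV[R]_m -> R -> R)
  (p_reg : forall theta, Theta theta -> regular_density (p theta))
  (p_ident : forall theta theta', Theta theta -> Theta theta' ->
     theta <> theta' -> p theta <> p theta')
  (d : measure_display) (Omega : measurableType d) (P : probability Omega R)
  (P_complete : measure_is_complete P)
  (theta0 : 'rV[R]_m) (theta0_in : Theta theta0)
  (X : {RV P >-> R}) (Xs : nat -> {RV P >-> R})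
  (X_pos : forall omega, 0 < X omega)
  (Xs_pos : forall j omega, 0 < Xs j omega)
  (X_density : has_density X (p theta0))
  (Xs_density : forall j, has_density (Xs j) (p theta0))
  (Xs_indep : mutually_independent Xs)
  (score_int : forall theta, Theta theta ->
     ('E_P[fun omega => `|score (p theta) (X omega) * X omega|%R] < +oo)%E)
  (q : R) (q_ge1 : 1 <= q) (w : R -> R)
  (w_pos : forall t : R, 0 < t -> 0 < w t)
  (w_int : (@lebesgue_measure R).-integrable `]0, +oo[ (EFin \o w))
  (eps : nat -> {RV P >-> R})
  (eps_pos : forall n omega, 0 < eps n omega)
  (eps_cvg : {ae P, forall omega, eps n omega @[n --> \oo] --> (0 : R)})
  (theta_hat : nat -> Omega -> 'rV[R]_m)
  (theta_hat_in : forall n omega, Theta (theta_hat n omega))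
  (theta_hat_meas : forall n, measurable_fun [set: Omega]
     (theta_hat n : Omega -> g_sigma_algebraType (@open 'rV[R]_m)))
  (theta_hat_min : forall n omega, (0 < n)%N ->
     (psi p Xs n q w (theta_hat n omega) omega <=
      ereal_inf [set psi p Xs n q w theta omega | theta in Theta]
      + (eps n omega)%:E)%E)
  (R1 : forall x : R, 0 < x ->
     {within Theta, continuous (fun theta => score (p theta) x)})
  (R2 : Theta !=set0 /\ borel_set Theta)
  (R3 : forall K : set 'rV[R]_m, compact K -> K !=set0 -> K `<=` Theta ->
     exists (alpha : R) (H : R -> R),
       [/\ 0 < alpha,
           measurable_fun (`]0, +oo[ : set R) H,
           (forall x : R, 0 < x -> 0 <= H x),
           ('E_P[fun omega => (H (X omega) * X omega)%R] < +oo)%E &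
           forall (x : R) (theta1 theta2 : 'rV[R]_m), 0 < x -> K theta1 -> K theta2 ->
             `|score (p theta2) x - score (p theta1) x| <=
               H x * euclidean_norm (theta2 - theta1) `^ alpha]) :
  (tight_in P Theta theta_hat -> cvg_in_probability P theta_hat theta0) /\
  (compact Theta ->
     {ae P, forall omega, theta_hat n omega @[n --> \oo] --> theta0}).
Proof.
pose nu := distribution P X.
have Xs_law j A : measurable A -> distribution P (Xs j) A = nu A.
  by move=> mA; rewrite Xs_density// -X_density.
have nuE A : measurable A ->
    (nu A = \int[lebesgue_measure]_(y in A) (p theta0 y)%:E)%E by exact: X_density.
have p0_cont (y : R) : 0 < y -> {for y, continuous (p theta0)}.
  by move=> y0; apply: regular_density_continuous y0; exact: p_reg.
have p0_int := regular_density_integrable (p_reg _ theta0_in).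
have s_meas theta : Theta theta ->
    measurable_fun (`]0, +oo[ : set R) (score (p theta)).
  by move=> /p_reg pr; apply: measurable_fun_pos_continuous; exact: score_continuous.
have s_int theta : Theta theta -> integrable_mean nu (fun y => score (p theta) y * y).
  move=> Tt; apply: integrable_mean_distribution => //; last exact: score_int.
  by apply: measurable_funM => //; exact: s_meas.
(* The neighbourhood [U] is quantified inside, so one null set serves all of them. [K] is [Theta] in
   the compact case, and a tightness set enlarged by [theta0] in the other. *)
have main (K : set 'rV[R]_m) : compact K -> K `<=` Theta -> K theta0 ->
    {ae P, forall omega, forall U, nbhs theta0 U ->
      \forall n \near \oo, K (theta_hat n omega) -> U (theta_hat n omega)}.
  move=> cK KT K0.
  have K_ne : K !=set0 by exists theta0.
  have [alpha [H [alpha0 mH H0 Hoo Hlip]]] := R3 K cK K_ne KT.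
  have H_int : integrable_mean nu (fun y => H y * y).
    apply: integrable_mean_distribution => //; first exact: measurable_funM.
    move: Hoo; congr (_ < _)%E; congr ('E_P[_])%E; apply/funext => omega.
    by rewrite ger0_norm// mulr_ge0 ?H0// ltW.
  have [D [DK Ddense]] := compact_countable_dense cK K_ne.
  have D_small theta e : K theta -> 0 < e ->
      exists k, euclidean_norm (D k - theta) `^ alpha <= e.
    move=> Kt e0.
    have /nbhs_ballP[r r0 tr] := euclidean_dist_powR_small theta alpha0 e0.
    by have [k /tr] := Ddense theta r Kt r0; exists k.
  have min_int k (r : rat) : 0 < ratr r :> R ->
      integrable_mean nu (fun y => score (p (D k)) y * Num.min y (ratr r)).
    move=> r0; exact: (@integrable_mean_min _ nu _ (fun th => score (p th)) Theta
      s_meas s_int _ _ (KT _ (DK k)) r0).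
  have avg_min : {ae P, forall omega, forall kr : nat * rat, 0 < ratr kr.2 :> R ->
      avg (fun j => Xs j omega) n
        (fun y => score (p (D kr.1)) y * Num.min y (ratr kr.2)) @[n --> \oo] -->
      mean nu (fun y => score (p (D kr.1)) y * Num.min y (ratr kr.2))}.
    apply: ae_forall_countable => -[k r] /=.
    have [r0|r0] := ltP 0 (ratr r : R); last first.
      exact: aeW.
    have := strong_law_mean Xs_pos Xs_indep Xs_law (min_int k r r0).
    by apply: filterS.
  have norm_int theta : Theta theta ->
      integrable_mean nu (fun y => `|score (p theta) y * y|).
    exact: (@integrable_mean_norm _ nu _ (fun th => score (p th)) Theta s_meas s_int).
  have avg_norm : {ae P, forall omega, forall k,
      avg (fun j => Xs j omega) n (fun y => `|score (p (D k)) y * y|) @[n --> \oo] -->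
      mean nu (fun y => `|score (p (D k)) y * y|)}.
    apply: ae_forall_countable => k.
    exact: (strong_law_mean Xs_pos Xs_indep Xs_law (norm_int _ (KT _ (DK k)))).
  have avg_norm0 := strong_law_mean Xs_pos Xs_indep Xs_law (norm_int _ theta0_in).
  have avg_H := strong_law_mean Xs_pos Xs_indep Xs_law H_int.
  have avg_cdf : {ae P, forall omega, forall r : rat,
      avg (fun j => Xs j omega) n \1_(`]-oo, ratr r]) @[n --> \oo] -->
      distribution_function (p theta0) (ratr r)}.
    apply: ae_forall_countable => r.
    exact: (strong_law_cdf Xs_indep Xs_law (ratr r) X_density).
  near=> omega.
  apply: (@argmin_consistent R m Theta p theta0 p_reg p_ident theta0_in nu nuE s_int
    q w (fun j => Xs j omega) K H alpha q_ge1 w_pos w_int _ cK KT K0 alpha0 _ _ _ _ _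
    (fun n => theta_hat n omega) (fun n => eps n omega)) => //.
  - move=> theta t Kt t0.
    apply: (@cvg_avg_min R nu _ (fun th => score (p th)) K H
      (fun i j => euclidean_norm (j - i) `^ alpha) D) => //.
    + by move=> i /KT; exact: s_meas.
    + by move=> i /KT; exact: s_int.
    + by move=> k r r0; apply: (near avg_min omega _ (k, r)).
    + by move=> k; apply: (near avg_norm omega).
    + by apply: (near avg_H omega).
  - move=> t t0; apply: cvg_avg_indic => //.
      apply/differentiable_continuous/derivable1_diffP.
      by have [] := is_derive_distribution_function p0_cont p0_int t0.
    by move=> r; apply: (near avg_cdf omega).
  - by apply: (near avg_norm0 omega).
  - by apply: (near avg_H omega).
  - move=> n n0; apply: (le_trans (theta_hat_min n omega n0)).
    by rewrite leeD2r//; apply: ereal_inf_lbound; exists theta0.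
  - by apply: (near eps_cvg omega).
have meas_open n (U : set 'rV[R]_m) : open U -> measurable (theta_hat n @^-1` U).
  move=> oU; rewrite -[X in measurable X]setTI; apply: theta_hat_meas => //.
  exact: sub_sigma_algebra.
split=> [tight r r0|cTheta].
- pose A n := [set omega | r < euclidean_norm (theta_hat n omega - theta0)].
  have mA n : measurable (A n).
    apply: (meas_open n [set theta | r < euclidean_norm (theta - theta0)]).
    apply: (@open_comp _ _ (fun theta : 'rV[R]_m => euclidean_norm (theta - theta0))
      [set y : R | r < y]); last exact: open_gt.
    by move=> u _; exact: continuous_euclidean_dist.
  apply/fine_cvgP; split; first by apply: nearW => n; rewrite fin_num_measure//; exact: mA.
  apply/cvgrPdist_le => e e0; have e2 : 0 < e / 2 by rewrite divr_gt0.
  have [K' [cK' K'T K'e]] := tight _ e2.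
  (* The set given by tightness may miss [theta0], with which the minimizers are compared. *)
  pose K := K' `|` [set theta0].
  have cK : compact K by apply: compactU => //; exact: compact_set1.
  have KT : K `<=` Theta by move=> theta [/K'T//|->].
  pose C n := [set omega | ~ K' (theta_hat n omega)].
  have mC n : measurable (C n).
    apply: (meas_open n (~` K')); apply: closed_openC.
    by apply: compact_closed => //; exact: norm_hausdorff.
  (* On [B n] the estimator is in [K'] but far from [theta0]. Almost surely this happens finitely
     often, so [P (B n)] tends to 0 by dominated convergence, while tightness bounds [P (C n)]. *)
  pose B n := A n `\` C n.
  have mB n : measurable (B n) by exact: measurableD.
  have B0 : P (B n) @[n --> \oo] --> 0%E.
    have -> : (fun n => P (B n)) = (fun n => \int[P]_omega (\1_(B n) omega)%:E)%E.
      by apply/funext => n; rewrite integral_indic// setIT.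
    rewrite -(@integral0 _ _ _ P setT).
    have [|||||_ _] := @dominated_convergence _ _ _ P setT measurableT
      (fun n omega => (\1_(B n) omega)%:E) (cst 0%E) (cst 1%E).
    + by move=> n; apply/measurable_EFinP; exact: measurable_indic.
    + exact: measurable_cst.
    + have := main K cK KT (or_intror erefl); apply: filterS => omega H _.
      have U0 : nbhs theta0 [set theta | euclidean_norm (theta - theta0) <= r].
        have := @continuous_euclidean_dist R m theta0 theta0.
        rewrite /continuous_at euclidean_dist0 => /cvgr_le/(_ _ r0).
        exact.
      apply: cvg_near_cst; have := H _ U0; apply: filterS => n Hn.
      rewrite indicE memNset// => -[rn /contrapT K'n].
      have := Hn (or_introl K'n); rewrite /= leNgt => /negP; apply; exact: rn.
    + exact: finite_measure_integrable_cst.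
    + apply: aeW => omega n _.
      by rewrite lee_fin ger0_norm// indicE.
    + exact: id.
  have finB n : P (B n) \is a fin_num by exact: fin_num_measure.
  move/fine_cvgP : B0 => [_ /cvgrPdist_le/(_ _ e2)] [N _ HN].
  (* The successor excludes the sample size 0, about which tightness says nothing. *)
  exists N.+1 => // n /= Nn; have {}HN := HN n (ltnW Nn).
  rewrite sub0r normrN ger0_norm ?fine_ge0// -lee_fin fineK; last first.
    by rewrite fin_num_measure//; exact: mA.
  have CE : (P (C n) <= (e / 2)%:E)%E.
    apply: le_trans K'e; apply: ereal_sup_ubound; exists n => //=.
    exact: leq_trans Nn.
  have BE : (P (B n) <= (e / 2)%:E)%E.
    rewrite -(fineK (finB n)) lee_fin.
    by move: HN; rewrite /= sub0r normrN; apply: le_trans; exact: ler_norm.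
  rewrite [e]splitr EFinD; apply: le_trans (leeD BE CE).
  apply: le_trans (measureU2 _ _ _) => //.
  apply: le_measure; rewrite ?inE; [exact: mA|exact: measurableU|].
  move=> omega An; have [Cn|Cn] := pselect (C n omega); first by right.
  by left.
- have consistent := main Theta cTheta (fun _ => id) theta0_in.
  apply: filterS consistent => omega H U U0; have [N _ HN] := H U U0.
  by exists N => // n Nn; apply: HN => //; exact: theta_hat_in.
Unshelve. all: end_near. Qed.
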